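(* Let $M$ be a paracompact smooth manifold, $A$ a Weil algebra and $M^{A}$ the associated Weil bundle. If $\nabla$ is a linear connection on $M$, then there exists one and only one linear application $$\nabla^{A}:\mathfrak{X}(M^{A})\longrightarrow \mathrm{End}_{A}[\mathfrak{X}(M^{A})],\quad X\longmapsto\nabla_{X}^{A}$$ such that $$\nabla_{\theta^{A}}^{A}\eta^{A}=\left(\nabla_{\theta}\eta\right)^{A}$$ for any $\theta,\eta\in\mathfrak{X}(M)$.
   Context: A Weil algebra $A$ is a finite-dimensional commutative associative unital local $\mathbb{R}$-algebra $A=\mathbb{R}\oplus\mathfrak{m}$ with nilpotent maximal ideal $\mathfrak{m}$. The Weil bundle $M^{A}$ is the manifold of infinitely near points of kind $A$: its points are the $\mathbb{R}$-algebra homomorphisms $\xi:C^{\infty}(M)\to A$ for which there is $x\in M$ with $\xi(f)-f(x)\in\mathfrak{m}$ for all $f\in C^{\infty}(M)$. If $(U,\varphi)$ is a chart of $M$ with coordinates $(x_1,\dots,x_n)$, then $U^{A}\to A^{n}$, $\xi\mapsto(\xi(x_1),\dots,\xi(x_n))$ is a chart of $M^{A}$ (a bijection onto an open subset of $A^n$). $C^{\infty}(M^{A},A)$ is the $A$-algebra of smooth functions on $M^{A}$ with values in $A$. For $f\in C^{\infty}(M)$, $f^{A}\in C^{\infty}(M^{A},A)$ is defined by $f^{A}(\xi)=\xi(f)$. $\mathfrak{X}(M)$ is the $C^\infty(M)$-module of vector fields on $M$, viewed as derivations of $C^{\infty}(M)$. A linear connection on $M$ is given by a $C^{\infty}(M)$-linear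 map $\nabla:\mathfrak{X}(M)\to\mathrm{End}_{\mathbb{R}}[\mathfrak{X}(M)]$, $\theta\mapsto\nabla_{\theta}$, such that $\nabla_{\theta}(f\cdot\mu)=\theta(f)\cdot\mu+f\cdot\nabla_{\theta}\mu$ for all $f\in C^{\infty}(M)$ and $\theta,\mu\in\mathfrak{X}(M)$. A vector field on $M^{A}$ is regarded as an $A$-linear map $X:C^{\infty}(M^{A},A)\to C^{\infty}(M^{A},A)$ with $X(\varphi\psi)=X(\varphi)\psi+\varphi X(\psi)$ for all $\varphi,\psi\in C^{\infty}(M^{A},A)$; that is, $\mathfrak{X}(M^{A})=\mathrm{Der}_{A}[C^{\infty}(M^{A},A)]$, which is a $C^{\infty}(M^{A},A)$-module. For $\theta\in\mathfrak{X}(M)$, its prolongation $\theta^{A}\in\mathfrak{X}(M^{A})$ is the one and only $A$-linear derivation of $C^{\infty}(M^{A},A)$ such that $\theta^{A}(f^{A})=[\theta(f)]^{A}$ for all $f\in C^{\infty}(M)$. $\mathrm{End}_{A}[\mathfrak{X}(M^{A})]$ is the set of $A$-linear maps from $\mathfrak{X}(M^{A})$ to itself; it is a $C^{\infty}(M^{A},A)$-module.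
   Formalization: Smooth functions on M^A with values in A are taken to be smooth over A (C^∞ with A-linear differential); with all real-smooth A-valued functions the prolongation θ^A is not unique, e.g. ∂_y − e∂_x kills every f^A for M = ℝ, A = ℝ[e]/(e²). *)

(* Defs.v *)
From HB Require Import structures.
From mathcomp Require Import all_boot all_order all_algebra all_field.
From mathcomp Require Import all_classical all_reals all_analysis.
Set Implicit Arguments.
Unset Strict Implicit.
Unset Printing Implicit Defensive.
Import Order.TTheory GRing.Theory Num.Theory numFieldNormedType.Exports.
Local Open Scope classical_set_scope.
Local Open Scope ring_scope.

Section Smoothness.
Variables (R : realType) (V : normedModType R).

(* Used with O open only: the value at a point of O of the derivatives of f
   then depends on the restriction of f to O alone. *)
Fixpoint Ck (k : nat) (O : set V) (f : V -> R) : Prop :=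
  (forall x, O x -> {for x, continuous f}) /\
  match k with
  | 0%N => True
  | k'.+1 => forall v : V, (forall x, O x -> derivable f x v) /\
                           Ck k' O ('D_v f)
  end.

(* For an open D, one can take O = D. *)
Definition smooth_on (D : set V) (f : V -> R) : Prop :=
  exists O : set V, [/\ open O, D `<=` O & forall k, Ck k O f].

Lemma Ck_continuous k (O : set V) (f : V -> R) (x : V) :
  Ck k O f -> O x -> {for x, continuous f}.
Proof. by case: k => [|k] [h _]; exact: h. Qed.

Lemma Ck_eq k (O : set V) (f g : V -> R) : open O ->
  (forall x, O x -> f x = g x) -> Ck k O f -> Ck k O g.
Proof.
move=> oO; elim: k f g => [|k IH] f g fg Cf.
all: have nfg x : O x -> \near x, f x = g x
  by move=> Ox; near=> y; apply: fg; near: y; exact: open_nbhs_nbhs.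
all: have cg x : O x -> {for x, continuous g}
  by move=> Ox; move: (Ck_continuous Cf Ox);
     rewrite /prop_for /continuous_at -(fg x Ox) => h;
     apply: cvg_trans h; apply: near_eq_cvg;
     apply: filterS (nfg x Ox) => y ->.
  by split.
case: Cf => _ df; split=> // v; have [dfv Cv] := df v; split=> [x Ox|].
  exact: near_eq_derivable (nfg x Ox) (dfv x Ox).
by apply: IH Cv => x Ox; exact: near_eq_derive (nfg x Ox).
Unshelve. all: by end_near. Qed.

Lemma Ck_sub k (O U : set V) f : O `<=` U -> Ck k U f -> Ck k O f.
Proof.
move=> OU; elim: k f => [|k IH] f [cf df]; split=> //; first by move=> x /OU /cf.
  by move=> x /OU /cf.
by move=> v; have [dfv Cv] := df v; split; [move=> x /OU /dfv|exact: IH].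
Qed.

Lemma Ck_pred k (O : set V) f : Ck k.+1 O f -> Ck k O f.
Proof.
elim: k f => [|k IH] f [cf df]; split=> // v.
by have [dfv Cv] := df v; split=> //; exact: IH.
Qed.

Lemma Ck_cst k (O : set V) (c : R) : open O -> Ck k O (cst c).
Proof.
move=> oO; elim: k c => [|k IH] c; split=> //.
- by move=> x _; exact: cst_continuous.
- by move=> x _; exact: cst_continuous.
move=> v; split=> [x _|]; first exact: derivable_cst.
by apply: Ck_eq (IH 0) => // x _; rewrite derive_cst.
Qed.

Lemma Ck_add k (O : set V) (f g : V -> R) : open O ->
  Ck k O f -> Ck k O g -> Ck k O (f + g).
Proof.
move=> oO; elim: k f g => [|k IH] f g Cf Cg.
all: have c x : O x -> {for x, continuous (f + g)}
  by move=> Ox; apply: continuousD; [exact: Ck_continuous Cf Ox|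
                                     exact: Ck_continuous Cg Ox].
  by split.
case: Cf Cg => _ df [_ dg]; split=> // v.
have [dfv Cfv] := df v; have [dgv Cgv] := dg v; split=> [x Ox|].
  by apply: derivableD; [exact: dfv|exact: dgv].
by apply: Ck_eq (IH _ _ Cfv Cgv) => // x Ox; rewrite deriveD//;
  [exact: dfv|exact: dgv].
Qed.

Lemma Ck_mul k (O : set V) (f g : V -> R) : open O ->
  Ck k O f -> Ck k O g -> Ck k O (f * g).
Proof.
move=> oO; elim: k f g => [|k IH] f g Cf Cg.
all: have c x : O x -> {for x, continuous (f * g)}
  by move=> Ox; apply: continuousM; [exact: Ck_continuous Cf Ox|
                                     exact: Ck_continuous Cg Ox].
  by split.
have [Cf' Cg'] := (Ck_pred Cf, Ck_pred Cg).
case: Cf Cg => _ df [_ dg]; split=> // v.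
have [dfv Cfv] := df v; have [dgv Cgv] := dg v; split=> [x Ox|].
  by apply: derivableM; [exact: dfv|exact: dgv].
apply: Ck_eq (Ck_add oO (IH _ _ Cf' Cgv) (IH _ _ Cg' Cfv)) => // x Ox.
by rewrite deriveM//; [exact: dfv|exact: dgv].
Qed.

Lemma smooth_on_eq (D : set V) (f g : V -> R) :
  f =1 g -> smooth_on D f -> smooth_on D g.
Proof. by move=> /funext ->. Qed.

Lemma smooth_on_cst (D : set V) (c : R) : smooth_on D (cst c).
Proof. by exists setT; split=> //; [exact: openT|move=> k; exact/Ck_cst/openT]. Qed.

Lemma smooth_on_add (D : set V) (f g : V -> R) :
  smooth_on D f -> smooth_on D g -> smooth_on D (f + g).
Proof.
move=> [W [oO DO CO]] [U [oU DU CU]]; exists (W `&` U).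
have oOU := openI oO oU; split=> //; first by move=> x Dx; split; [exact: DO|exact: DU].
move=> k.
by apply: Ck_add => //; [apply: Ck_sub (CO k) => y []|apply: Ck_sub (CU k) => y []].
Qed.

Lemma smooth_on_mul (D : set V) (f g : V -> R) :
  smooth_on D f -> smooth_on D g -> smooth_on D (f * g).
Proof.
move=> [W [oO DO CO]] [U [oU DU CU]]; exists (W `&` U).
have oOU := openI oO oU; split=> //; first by move=> x Dx; split; [exact: DO|exact: DU].
move=> k.
by apply: Ck_mul => //; [apply: Ck_sub (CO k) => y []|apply: Ck_sub (CU k) => y []].
Qed.

Lemma smooth_on_opp (D : set V) (f : V -> R) : smooth_on D f -> smooth_on D (- f).
Proof.
move=> sf; apply: smooth_on_eq (smooth_on_mul (smooth_on_cst D (-1)) sf) => x.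
by rewrite mulrfctE mulN1r.
Qed.

Lemma smooth_on_sum (D : set V) (I : finType) (F : I -> V -> R) :
  (forall i, smooth_on D (F i)) -> smooth_on D (\sum_i F i).
Proof.
move=> sF; apply: (big_ind (smooth_on D)) => //; first exact: (smooth_on_cst D 0).
exact: smooth_on_add.
Qed.

Lemma smooth_on_derivable (D : set V) (f : V -> R) (x v : V) :
  smooth_on D f -> D x -> derivable f x v.
Proof. by move=> [W [_ DO /(_ 1%N) [_ df]]] /DO; case: (df v) => + _; exact. Qed.
End Smoothness.

Section Manifolds.
Variables (R : realType) (n : nat).

(* The inverse is only meaningful on the image of the domain. *)
Record chart (T : topologicalType) := Chart {
  cdom : set T;
  cmap :> T -> 'rV[R]_n;
  cinv : 'rV[R]_n -> T }.

Definition cimg (T : topologicalType) (c : chart T) : set 'rV[R]_n :=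
  c @` cdom c.

Definition is_chart (T : topologicalType) (c : chart T) : Prop :=
  [/\ open (cdom c), open (cimg c),
      forall x, cdom c x -> cinv c (c x) = x,
      forall x, cdom c x -> {for x, continuous c} &
      forall y, cimg c y -> {for y, continuous (cinv c)}].

Definition compatible (T : topologicalType) (c d : chart T) : Prop :=
  forall i : 'I_n,
    smooth_on (c @` (cdom c `&` cdom d)) (fun y => d (cinv c y) 0 i).

Definition paracompact (T : topologicalType) : Prop :=
  forall U : set (set T), (forall A, U A -> open A) -> \bigcup_(A in U) A = setT ->
  exists W : set (set T),
    [/\ forall B, W B -> open B /\ exists2 A, U A & B `<=` A,
        \bigcup_(B in W) B = setT &
        forall x : T, exists2 N, nbhs x N &
          finite_set [set B | W B /\ B `&` N !=set0]].

Record manifold := Manifold {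
  point_space :> topologicalType;
  atlas : set (chart point_space);
  atlas_chart : forall c, atlas c -> is_chart c;
  atlas_cover : forall x, exists2 c, atlas c & cdom c x;
  atlas_compatible : forall c d, atlas c -> atlas d -> compatible c d;
  manifold_hausdorff : hausdorff_space point_space }.

Variable M : manifold.

Definition smooth_fun : {pred M -> R} :=
  mem [set f : M -> R |
    forall c, atlas c -> smooth_on (cimg c) (f \o cinv c)].

Lemma smooth_funP (f : M -> R) : f \in smooth_fun <->
  forall c, atlas c -> smooth_on (cimg c) (f \o cinv c).
Proof. by split=> [/set_mem|?] //; apply/mem_set. Qed.

Lemma smooth_fun_cst (a : R) : cst a \in smooth_fun.
Proof. by apply/smooth_funP => c _; exact: smooth_on_cst. Qed.

Lemma smooth_fun_subring : subring_closed smooth_fun.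
Proof.
split; first exact: (smooth_fun_cst 1).
  move=> f g /smooth_funP sf /smooth_funP sg; apply/smooth_funP => c Mc.
  exact: smooth_on_add (sf c Mc) (smooth_on_opp (sg c Mc)).
move=> f g /smooth_funP sf /smooth_funP sg; apply/smooth_funP => c Mc.
exact: smooth_on_mul (sf c Mc) (sg c Mc).
Qed.

Record Cinf := MkCinf { Cinf_fun :> M -> R; _ : Cinf_fun \in smooth_fun }.
HB.instance Definition _ := [isSub for Cinf_fun].
HB.instance Definition _ := [Choice of Cinf by <:].
HB.instance Definition _ :=
  GRing.SubChoice_isSubComPzRing.Build _ _ Cinf smooth_fun_subring.

Definition Cinf_cst (a : R) : Cinf := MkCinf (smooth_fun_cst a).
Lemma Cinf_cst_zmod : zmod_morphism Cinf_cst.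
Proof. by move=> a b; apply/val_inj/funext. Qed.
Lemma Cinf_cst_monoid : monoid_morphism Cinf_cst.
Proof. by split=> [|a b]; apply/val_inj/funext. Qed.
HB.instance Definition _ :=
  GRing.isZmodMorphism.Build R Cinf Cinf_cst Cinf_cst_zmod.
HB.instance Definition _ :=
  GRing.isMonoidMorphism.Build R Cinf Cinf_cst Cinf_cst_monoid.
End Manifolds.

(* Derivations of a commutative ring B over a ring morphism j : k -> B, that is,
   of the k-algebra B.  C^oo(M) is the zero ring when M is empty, so that the
   algebra structures of the library, whose rings are nontrivial, do not apply. *)
Section Derivations.
Variables (k : pzRingType) (B : comPzRingType) (j : {rmorphism k -> B}).

Definition is_derivation (X : B -> B) : Prop :=
  (forall a f g, X (j a * f + g) = j a * X f + X g) /\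
  (forall f g, X (f * g) = X f * g + f * X g).

Record Der := MkDer { der_fun :> B -> B; derP : is_derivation der_fun }.

Lemma der_ext (X Y : Der) : (forall f, X f = Y f) -> X = Y.
Proof.
case: X Y => [X HX] [Y HY] /= /funext XY; rewrite XY in HX *.
by rewrite (Prop_irrelevance HX HY).
Qed.

Lemma der0P : is_derivation (fun=> 0).
Proof. by split=> [a f g|f g]; rewrite ?mulr0 ?mul0r addr0. Qed.

Lemma derNP (X : Der) : is_derivation (fun f => - X f).
Proof.
have [XD XM] := derP X; split=> [a f g|f g]; first by rewrite XD opprD mulrN.
by rewrite XM opprD mulNr mulrN.
Qed.

Lemma derDP (X Y : Der) : is_derivation (fun f => X f + Y f).
Proof.
have [[XD XM] [YD YM]] := (derP X, derP Y); split=> [a f g|f g].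
  by rewrite XD YD mulrDr addrACA.
by rewrite XM YM mulrDl mulrDr addrACA.
Qed.

Lemma derZP (b : B) (X : Der) : is_derivation (fun f => b * X f).
Proof.
have [XD XM] := derP X; split=> [a f g|f g].
  by rewrite XD mulrDr mulrCA.
by rewrite XM mulrDr mulrA (mulrCA b f).
Qed.

HB.instance Definition _ := gen_eqMixin Der.
HB.instance Definition _ := gen_choiceMixin Der.

Definition der0 := MkDer der0P.
Definition derN X := MkDer (derNP X).
Definition derD X Y := MkDer (derDP X Y).
Definition derZ b X := MkDer (derZP b X).

Lemma derDA : associative derD.
Proof. by move=> X Y Z; apply: der_ext => f /=; rewrite addrA. Qed.
Lemma derDC : commutative derD.
Proof. by move=> X Y; apply: der_ext => f /=; rewrite addrC. Qed.
Lemma der0D : left_id der0 derD.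
Proof. by move=> X; apply: der_ext => f /=; rewrite add0r. Qed.
Lemma derND : left_inverse der0 derN derD.
Proof. by move=> X; apply: der_ext => f /=; rewrite addNr. Qed.
HB.instance Definition _ := GRing.isZmodule.Build Der derDA derDC der0D derND.

Lemma derZA a b X : derZ a (derZ b X) = derZ (a * b) X.
Proof. by apply: der_ext => f /=; rewrite mulrA. Qed.
Lemma derZ1 : left_id 1 derZ.
Proof. by move=> X; apply: der_ext => f /=; rewrite mul1r. Qed.
Lemma derZDr : right_distributive derZ +%R.
Proof. by move=> a X Y; apply: der_ext => f /=; rewrite mulrDr. Qed.
Lemma derZDl X : {morph derZ^~ X : a b / a + b}.
Proof. by move=> a b; apply: der_ext => f /=; rewrite mulrDl. Qed.
HB.instance Definition _ :=
  GRing.Zmodule_isLmodule.Build B Der derZA derZ1 derZDr derZDl.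

(* B-linear maps from Der to End_k(Der), the latter with its pointwise
   B-module structure. *)
Definition linear_to_End (D : Der -> Der -> Der) : Prop :=
  (forall b X X' Y, D (b *: X + X') Y = b *: D X Y + D X' Y) /\
  (forall X a Y Y', D X (j a *: Y + Y') = j a *: D X Y + D X Y').
End Derivations.

Notation vect M := (Der (@Cinf_cst _ _ M)).

Definition linear_connection (R : realType) (n : nat) (M : manifold R n)
    (nabla : vect M -> vect M -> vect M) : Prop :=
  linear_to_End nabla /\
  forall (f : Cinf M) (theta mu : vect M),
    nabla theta (f *: mu) = theta f *: mu + f *: nabla theta mu.

(* wbasis is any basis of A and wcoord the coordinates in it; wideal is the
   maximal ideal m. *)
HB.mixin Record isWeil (R : fieldType) A of GRing.ComAlgebra R A := {
  wdim : nat;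
  wbasis : 'I_wdim -> A;
  wcoord : 'I_wdim -> A -> R;
  wcoordE : forall a : A, a = \sum_j wcoord j a *: wbasis j;
  wcoord_sum : forall (c : 'I_wdim -> R) (j : 'I_wdim),
    wcoord j (\sum_i c i *: wbasis i) = c j;
  wideal : set A;
  widealD : forall a b : A, wideal a -> wideal b -> wideal (a + b);
  widealM : forall a b : A, wideal b -> wideal (a * b);
  wideal_local : forall a : A, wideal a <-> ~ exists b : A, a * b = 1;
  wideal_compl : forall a : A, exists! c : R, wideal (a - c%:A);
  wideal_nilpotent : exists k : nat, forall s : 'I_k -> A,
    (forall i, wideal (s i)) -> \prod_i s i = 0 }.
#[short(type="weilAlgType")]
HB.structure Definition WeilAlgebra (R : fieldType) :=
  {A of GRing.ComAlgebra R A & isWeil R A}.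

(* A^n is 'rV[A]_n; it is identified with R^(n * dim A), realised as matrices,
   through a basis of A, so as to speak of derivatives. *)
Section ASmoothness.
Variables (R : realType) (n : nat) (A : weilAlgType R).
Local Notation dimA := (@wdim R A).

Definition mx_of (v : 'rV[A]_n) : 'M[R]_(n, dimA) :=
  \matrix_(i, j) wcoord j (v 0 i).
Definition of_mx (X : 'M[R]_(n, dimA)) : 'rV[A]_n :=
  \row_i \sum_j X i j *: wbasis j.
Definition Acoord (F : 'rV[A]_n -> A) (j : 'I_dimA) : 'M[R]_(n, dimA) -> R :=
  fun X => wcoord j (F (of_mx X)).
Definition diffA (F : 'rV[A]_n -> A) (x v : 'rV[A]_n) : A :=
  \sum_j 'D_(mx_of v) (Acoord F j) (mx_of x) *: wbasis j.

(* Smoothness over A: of class C^oo over R, with A-linear differential. *)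
Definition A_smooth_on (D : set 'rV[A]_n) (F : 'rV[A]_n -> A) : Prop :=
  (forall j, smooth_on (mx_of @` D) (Acoord F j)) /\
  (forall x, D x -> forall (a : A) (v : 'rV[A]_n),
     diffA F x (a *: v) = a * diffA F x v).

Lemma wcoord_linear j : linear (wcoord j : A -> R).
Proof.
move=> c a b; have -> : c *: a + b =
    \sum_i (c * wcoord i a + wcoord i b) *: wbasis i.
  rewrite {1}(wcoordE a) {1}(wcoordE b) scaler_sumr -big_split /=.
  by apply: eq_bigr => i _; rewrite scalerA scalerDl.
by rewrite wcoord_sum.
Qed.
HB.instance Definition _ j :=
  GRing.isLinear.Build R A R _ (wcoord j : A -> R) (wcoord_linear j).

Lemma mx_ofK : cancel mx_of of_mx.
Proof.
move=> v; apply/rowP => i; rewrite mxE [RHS]wcoordE.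
by apply: eq_bigr => j _; rewrite mxE.
Qed.

Lemma coord_diffA F x v j :
  wcoord j (diffA F x v) = 'D_(mx_of v) (Acoord F j) (mx_of x).
Proof. exact: wcoord_sum. Qed.

Lemma A_smooth_on_cst D (a : A) : A_smooth_on D (cst a).
Proof.
have c j : Acoord (cst a) j = cst (wcoord j a) by apply/funext.
split=> [j|x _ b v]; first by rewrite c; exact: smooth_on_cst.
have d w : diffA (cst a) x w = 0
  by rewrite /diffA big1// => j _; rewrite c derive_cst scale0r.
by rewrite !d mulr0.
Qed.

Lemma A_smooth_on_sub D F G :
  A_smooth_on D F -> A_smooth_on D G -> A_smooth_on D (F - G).
Proof.
move=> [sF lF] [sG lG].
have c j : Acoord (F - G) j = Acoord F j - Acoord G j
  by apply/funext => X; rewrite /Acoord /= linearB.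
split=> [j|x Dx a v].
  by rewrite c; exact: smooth_on_add (sF j) (smooth_on_opp (sG j)).
have d w : diffA (F - G) x w = diffA F x w - diffA G x w.
  rewrite /diffA -sumrB; apply: eq_bigr => j _; rewrite c.
  by rewrite deriveB ?scalerBl//; apply: smooth_on_derivable; (apply: sF || apply: sG
     || by exists x).
by rewrite !d lF// lG// mulrBr.
Qed.

Lemma A_smooth_on_mul D F G :
  A_smooth_on D F -> A_smooth_on D G -> A_smooth_on D (F * G).
Proof.
move=> [sF lF] [sG lG].
pose t j (p : 'I_dimA * 'I_dimA) : R := wcoord j (wbasis p.1 * wbasis p.2).
have cM (a b : A) j : wcoord j (a * b) =
    \sum_p wcoord p.1 a * wcoord p.2 b * t j p.
  rewrite {1}(wcoordE a) {1}(wcoordE b) mulr_suml linear_sum.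
  rewrite -(pair_bigA _ (fun k l => wcoord k a * wcoord l b * t j (k, l))) /=.
  apply: eq_bigr => k _; rewrite mulr_sumr linear_sum; apply: eq_bigr => l _.
  by rewrite -scalerAl -scalerAr !linearZ /= scalerA.
have c j : Acoord (F * G) j =
    \sum_p Acoord F p.1 * Acoord G p.2 * cst (t j p).
  apply/funext => X; rewrite fct_sumE /Acoord -[(F * G) _]/(F _ * G _) cM.
  by apply: eq_bigr.
split=> [j|x Dx a v].
  rewrite c; apply: smooth_on_sum => p.
  by do 2 ?[apply: smooth_on_mul]; [exact: sF|exact: sG|exact: smooth_on_cst].
have Dm : (mx_of @` D) (mx_of x) by exists x.
have d w : diffA (F * G) x w = diffA F x w * G x + F x * diffA G x w.
  rewrite [RHS]wcoordE; apply: eq_bigr => j _; congr (_ *: _).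
  have dF k : derivable (Acoord F k) (mx_of x) (mx_of w)
    by exact: smooth_on_derivable (sF k) Dm.
  have dG k : derivable (Acoord G k) (mx_of x) (mx_of w)
    by exact: smooth_on_derivable (sG k) Dm.
  have dt p : derivable (Acoord F p.1 * Acoord G p.2 * cst (t j p)) (mx_of x) (mx_of w).
    exact: derivableM (derivableM (dF _) (dG _)) (derivable_cst _ _ _).
  rewrite linearD /= !cM -big_split /= c.
  transitivity (\sum_p 'D_(mx_of w) (Acoord F p.1 * Acoord G p.2 * cst (t j p)) (mx_of x)).
    have : is_derive (mx_of x) (mx_of w)
       (\sum_p Acoord F p.1 * Acoord G p.2 * cst (t j p))
       (\sum_p 'D_(mx_of w) (Acoord F p.1 * Acoord G p.2 * cst (t j p)) (mx_of x)).
      apply: (big_ind2 (fun f (d : R) => is_derive (mx_of x) (mx_of w) f d)).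
      - exact: is_derive_cst.
      - by move=> *; exact: is_deriveD.
      - by move=> p _; exact: (DeriveDef (dt p)).
    by case.
  apply: eq_bigr => p _; rewrite (deriveM (derivableM (dF _) (dG _)) (derivable_cst _ _ _)).
  rewrite (deriveM (dF _) (dG _)) derive_cst scaler0 add0r !coord_diffA /Acoord mx_ofK.
  rewrite /GRing.scale /= mulrC mulrDl addrC; congr (_ + _).
  by congr (_ * _); rewrite mulrC.
by rewrite !d lF// lG// mulrDr -mulrA (mulrCA (F x)).
Qed.

End ASmoothness.

Section WeilBundle.
Variables (R : realType) (n : nat) (M : manifold R n) (A : weilAlgType R).

Definition near_to (xi : Cinf M -> A) (x : M) : Prop :=
  forall f : Cinf M, wideal (xi f - (f x)%:A).

Record weil_bundle := MkNearPoint {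
  near_point :> {rmorphism Cinf M -> A};
  near_pointZ : forall c : R, near_point (Cinf_cst M c) = c%:A;
  near_pointP : exists x : M, near_to near_point x }.

(* The value of xi at a function g that is only smooth near the point x to
   which xi is near: that of xi at any f in C^oo(M) with the germ of g at x. *)
Definition germ_value (xi : weil_bundle) (g : M -> R) : A :=
  xget 0 [set a | exists (x : M) (f : Cinf M),
    [/\ near_to xi x, \forall y \near x, f y = g y & a = xi f]].

Definition wdom (c : chart R n M) : set weil_bundle :=
  [set xi | exists2 x, cdom c x & near_to xi x].
Definition wchart (c : chart R n M) (xi : weil_bundle) : 'rV[A]_n :=
  \row_i germ_value xi (fun x => c x 0 i).

(* M^A is an A-manifold modelled on A^n, and C^oo(M^A, A) consists of the
   functions that are smooth over A.  With functions that are smooth over R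
   only, the prolongation of a vector field would not be determined by its
   values on the functions f^A: for M = R, A = R[e]/(e^2) and the real
   coordinates x + e y of M^A, the A-linear derivation d/dy - e d/dx of the
   algebra of all the real smooth A-valued functions vanishes on every f^A. *)
Definition wsmooth_fun : {pred weil_bundle -> A} :=
  mem [set phi : weil_bundle -> A | forall c, atlas c ->
    exists2 F : 'rV[A]_n -> A, A_smooth_on (wchart c @` wdom c) F &
      forall xi, wdom c xi -> phi xi = F (wchart c xi)].

Lemma wsmooth_funP (phi : weil_bundle -> A) : phi \in wsmooth_fun <->
  forall c, atlas c ->
    exists2 F : 'rV[A]_n -> A, A_smooth_on (wchart c @` wdom c) F &
      forall xi, wdom c xi -> phi xi = F (wchart c xi).
Proof. by split=> [/set_mem|?] //; apply/mem_set. Qed.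

Lemma wsmooth_fun_cst (a : A) : cst a \in wsmooth_fun.
Proof.
by apply/wsmooth_funP => c _; exists (cst a) => //; exact: A_smooth_on_cst.
Qed.

Lemma wsmooth_fun_subring : subring_closed wsmooth_fun.
Proof.
split; first exact: (wsmooth_fun_cst 1).
  move=> f g /wsmooth_funP sf /wsmooth_funP sg; apply/wsmooth_funP => c Mc.
  have [[F sF fF] [G sG gG]] := (sf c Mc, sg c Mc).
  exists (F - G); first exact: A_smooth_on_sub.
  by move=> xi cxi; rewrite !fctE fF// gG.
move=> f g /wsmooth_funP sf /wsmooth_funP sg; apply/wsmooth_funP => c Mc.
have [[F sF fF] [G sG gG]] := (sf c Mc, sg c Mc).
exists (F * G); first exact: A_smooth_on_mul.
by move=> xi cxi; rewrite !fctE fF// gG.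
Qed.

Record WCinf := MkWCinf {
  WCinf_fun :> weil_bundle -> A; _ : WCinf_fun \in wsmooth_fun }.
HB.instance Definition _ := [isSub for WCinf_fun].
HB.instance Definition _ := [Choice of WCinf by <:].
HB.instance Definition _ :=
  GRing.SubChoice_isSubComPzRing.Build _ _ WCinf wsmooth_fun_subring.

Definition WCinf_cst (a : A) : WCinf := MkWCinf (wsmooth_fun_cst a).
Lemma WCinf_cst_zmod : zmod_morphism WCinf_cst.
Proof. by move=> a b; apply/val_inj/funext. Qed.
Lemma WCinf_cst_monoid : monoid_morphism WCinf_cst.
Proof. by split=> [|a b]; apply/val_inj/funext. Qed.
HB.instance Definition _ :=
  GRing.isZmodMorphism.Build A WCinf WCinf_cst WCinf_cst_zmod.
HB.instance Definition _ :=
  GRing.isMonoidMorphism.Build A WCinf WCinf_cst WCinf_cst_monoid.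

(* f^A, which is the function xi |-> xi(f): the latter is always smooth, so that
   the default value 0 of insubd is never taken. *)
Definition prolong_fun (f : Cinf M) : WCinf :=
  insubd (0 : WCinf) (fun xi : weil_bundle => xi f).

End WeilBundle.

Notation wvect M A := (Der (@WCinf_cst _ _ M A)).

(* theta^A: there is exactly one such X. *)
Definition prolong_vect (R : realType) (n : nat) (M : manifold R n)
    (A : weilAlgType R) (theta : vect M) : wvect M A :=
  xget 0 [set X : wvect M A | forall f : Cinf M,
            X (prolong_fun A f) = prolong_fun A (theta f)].

(* Main.v *)
(* An A-smooth function vanishing at the real points of an open set vanishes on
   the whole fibres over it: by A-linearity of the differential, its derivative
   along a nilpotent direction is a combination of its derivatives with
   coefficients in the maximal ideal, and the ideal is nilpotent.  Taylor
   expansion in the nilpotent part extends every smooth real function to an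
   A-smooth one, which is the function [xi |-> xi f] in a chart (two near points
   with the same coordinates agree, by Hadamard's lemma).  Hence
   [C^oo(M^A, A) = A (x) C^oo(M)], whence [X(M^A) = A (x) X(M)], and
   [nablaA] is the A-bilinear extension of [nabla]. *)

Require Import Defs.
From HB Require Import structures.
From mathcomp Require Import all_boot all_order all_algebra all_field.
From mathcomp Require Import all_classical all_reals all_analysis.
From mathcomp Require Import ring lra.
Set Implicit Arguments.
Unset Strict Implicit.
Unset Printing Implicit Defensive.
Import Order.TTheory GRing.Theory Num.Theory numFieldNormedType.Exports.
Local Open Scope classical_set_scope.
Local Open Scope ring_scope.

(** * Directional derivatives *)

(** [Ck] records continuity and derivatives along one direction at a time. Linearity in the
    direction, symmetry of second derivatives and the chain rule are therefore not part of the
    definitions; all three are extracted from the mean value theorem on segments. Symmetry makes the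
    differential of the Taylor extension A-linear, and differentiation under the integral makes the
    coefficients in Hadamard's lemma smooth. The identification with a tensor product is made
    concrete through a basis of [A]: a function on the Weil bundle is restricted to the real points,
    where its coordinates are smooth functions on all of [M], and it is recovered as a finite sum
    over the basis. Charts serve only to verify this global identity. Fields are treated in the same
    way, and identities that are additive in each argument are then checked on generators [a f^A]
    and [a theta^A]. Nilpotency enters twice through the same induction [wideal_descent]: for the
    uniqueness of A-smooth functions and for the equality of near points with equal coordinates. *)

Lemma is_derive_affine (R : realType) (s a c : R) :
  is_derive s 1 (fun t : R => a + t * c) c.
Proof.
have h : is_derive s 1 (fun t : R => t * c) c.
  by apply: is_derive_eq; rewrite scaler0 add0r -[RHS]mulr1.
by have := is_deriveD (is_derive_cst a s 1) h; rewrite add0r.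
Qed.

Section DirectionalDerivative.
Context {R : realType} {V : normedModType R}.
Implicit Types (f : V -> R) (x v : V) (O : set V).

Lemma line_quotientE f x v (s : R) :
  (fun h : R => h^-1 *: (f (h *: v + (x + s *: v)) - f (x + s *: v))) =
  (fun h : R => h^-1 *: (((fun t : R => f (x + t *: v)) \o shift s) (h *: 1)
                        - f (x + s *: v))).
Proof.
apply/funext => h /=; congr (_ *: (f _ - _)).
by rewrite -[h *: 1]/(h * 1) mulr1 scalerDl addrCA.
Qed.

(** The bridge to one real variable: the two difference quotients are the same function, so the
    one-variable mean value theorem and chain rule become available for directional derivatives. *)
Lemma is_derive_lineP f x v (s d : R) :
  is_derive s 1 (fun t : R => f (x + t *: v)) d <-> is_derive (x + s *: v) v f d.
Proof.
split=> -[].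
- by rewrite /derivable /derive -line_quotientE => df dE; split.
- by rewrite /derivable /derive line_quotientE => df dE; split.
Qed.

Lemma is_derive_line0P f x v (d : R) :
  is_derive (0 : R) 1 (fun t : R => f (x + t *: v)) d <-> is_derive x v f d.
Proof. by rewrite is_derive_lineP scale0r addr0. Qed.

Lemma is_deriveZv f x v (c d : R) :
  is_derive x v f d -> is_derive x (c *: v) f (c * d).
Proof.
move=> /is_derive_line0P df; apply/is_derive_line0P.
have ic := is_derive_affine 0 0 c.
rewrite (_ : (fun t : R => _) = (fun t : R => f (x + t *: v)) \o (fun t => 0 + t * c)).
  by rewrite mulrC; apply: is_derive1_comp; rewrite mul0r addr0.
by apply/funext => t /=; rewrite add0r scalerA.
Qed.

Lemma MVT_line f x v :
  (forall s : R, 0 <= s <= 1 -> derivable f (x + s *: v) v) ->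
  exists2 s : R, 0 < s < 1 & f (x + v) - f x = 'D_v f (x + s *: v).
Proof.
move=> df; have dl (s : R) : 0 <= s <= 1 ->
    is_derive s 1 (fun t : R => f (x + t *: v)) ('D_v f (x + s *: v)).
  by move=> s01; apply/is_derive_lineP/derivableP/df.
have dlo (s : R) : s \in `]0, 1[ ->
    is_derive s 1 (fun t : R => f (x + t *: v)) ('D_v f (x + s *: v)).
  by rewrite in_itv/= => /andP[s0 s1]; apply: dl; rewrite !ltW.
have cl : {within `[(0 : R), 1], continuous (fun t : R => f (x + t *: v))}.
  apply: derivable_within_continuous => s; rewrite in_itv/= => s01.
  by have [] := dl s s01.
have [s] := MVT ltr01 dlo cl.
rewrite in_itv/= scale1r scale0r addr0 subr0 mulr1 => s01 ->.
by exists s.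
Qed.
End DirectionalDerivative.

(** * Additivity in the direction and symmetry of second derivatives *)

Section C1.
Context {R : realType} {V : normedModType R}.
Implicit Types (f : V -> R) (x u v : V) (O : set V).

Lemma nbhs_norm_ball x (N : set V) :
  nbhs x N -> exists2 e : R, 0 < e & forall y, `|y - x| < e -> N y.
Proof.
move=> /nbhs_normP[e /= e0 eN]; exists e => // y yx; apply: eN.
by rewrite /= distrC.
Qed.

Lemma near0_segment x u v (N : set V) : nbhs x N ->
  \forall t \near (0 : R), forall s : R, 0 <= s <= 1 ->
    N (x + t *: u + s *: (t *: v)).
Proof.
move=> /nbhs_norm_ball[e e0 eN].
(* The added 1 keeps the divisor positive when both directions vanish. *)
have uv0 : 0 < `|u| + `|v| + 1 by rewrite ltr_wpDl// addr_ge0.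
near=> t => s /andP[s0 s1]; apply: eN.
rewrite -(addrA x) (addrC x) addrK (le_lt_trans (ler_normD _ _))// !normrZ (ger0_norm s0).
have : `|t| * (`|u| + `|v| + 1) < e.
  rewrite -ltr_pdivlMr//; near: t; apply/nbhs_normP.
  exists (e / (`|u| + `|v| + 1)); first by rewrite /= divr_gt0.
  by move=> t /=; rewrite sub0r normrN.
apply: le_lt_trans; rewrite -addrA mulrDr lerD2l.
apply: (@le_trans _ _ (`|t| * `|v|)).
  by rewrite -[leRHS]mul1r ler_wpM2r// mulr_ge0.
by rewrite ler_wpM2l// lerDl.
Unshelve. all: by end_near. Qed.

Lemma Ck_derivable k O f x v : Ck k.+1 O f -> O x -> derivable f x v.
Proof. by move=> [_ /(_ v)[+ _]]; exact. Qed.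

Lemma Ck_derive k O f v : Ck k.+1 O f -> Ck k O ('D_v f).
Proof. by move=> [_ /(_ v)[]]. Qed.

Lemma deriveZv f x v (c : R) : derivable f x v -> 'D_(c *: v) f x = c * 'D_v f x.
Proof. by move=> /derivableP /is_deriveZv -/(_ c) []. Qed.

(** By the mean value theorem on the second leg of the path [x], [x + t u], [x + t u + t v], the
    difference of the quotients along [u + v] and along [u] is a value of ['D_v f] at a point that
    tends to [x]; continuity of ['D_v f] gives the limit. *)
Lemma C1_deriveDv O f x u v : open O -> Ck 1 O f -> O x ->
  'D_(u + v) f x = 'D_u f x + 'D_v f x.
Proof.
move=> oO Cf Ox.
have df y w : O y -> derivable f y w by exact: Ck_derivable Cf.
pose q w (t : R) : R := t^-1 *: (f (t *: w + x) - f x).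
have qE w : q w t @[t --> 0^'] --> 'D_w f x by exact: df.
rewrite [RHS]addrC; apply/eqP; rewrite -subr_eq; apply/eqP.
suff h : (q (u + v) - q u) t @[t --> 0^'] --> 'D_v f x.
  have H : (q (u + v) - q u) t @[t --> 0^'] --> 'D_(u + v) f x - 'D_u f x.
    exact: (cvgB (qE (u + v)) (qE u)).
  exact: (norm_cvg_unique H h).
apply/(@cvgrPdist_lt _ R^o) => e e0.
have nN : \forall y \near x, O y /\ `|'D_v f x - 'D_v f y| < e.
  near=> y; split; first by near: y; exact: open_nbhs_nbhs.
  near: y; move: e e0; apply/(@cvgrPdist_lt _ R^o).
  exact: Ck_continuous (Ck_derive v Cf) Ox.
near=> t.
have t0 : t != 0 by near: t; exact: nbhs_dnbhs_neq.
have Nt : forall s : R, 0 <= s <= 1 -> O (x + t *: u + s *: (t *: v)) /\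
    `|'D_v f x - 'D_v f (x + t *: u + s *: (t *: v))| < e.
  by near: t; apply: nbhs_dnbhs; exact: near0_segment nN.
have [s s01 E] : exists2 s : R, 0 < s < 1 & f (x + t *: u + t *: v) - f (x + t *: u) =
    'D_(t *: v) f (x + t *: u + s *: (t *: v)).
  apply: MVT_line => s /Nt[Os _].
  by case: (is_deriveZv t (derivableP (df _ v Os))).
have s01' : 0 <= s <= 1 by case/andP: s01 => *; rewrite !ltW.
have [Os lte] := Nt s s01'.
suff -> : (q (u + v) - q u) t = 'D_v f (x + t *: u + s *: (t *: v)) by [].
rewrite !fctE /q -scalerBr opprB addrA subrK (scalerDr t) [_ + x]addrC addrA.
rewrite [_ + x]addrC E deriveZv; last exact: df.
by rewrite -[_ *: _]/(_ * _) mulKf.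
Unshelve. all: by end_near. Qed.

Lemma C1_derive_sum O f x (I : finType) (w : I -> V) : open O -> Ck 1 O f -> O x ->
  'D_(\sum_i w i) f x = \sum_i 'D_(w i) f x.
Proof.
move=> oO Cf Ox; apply: (big_morph (fun w => 'D_w f x)); last exact: derive0.
by move=> u v; exact: C1_deriveDv Cf Ox.
Qed.

(* The rectangle [f (x + s u + t v) - f (x + s u) - f (x + t v) + f x] is
   [s t] times a value of either mixed derivative near [x]. *)
Lemma C2_derive_derive O f x u v : open O -> Ck 2 O f -> O x ->
  'D_u ('D_v f) x = 'D_v ('D_u f) x.
Proof.
move=> oO Cf Ox.
have Cw w : Ck 1 O ('D_w f) by exact: Ck_derive.
have df w y : O y -> derivable f y w by exact: Ck_derivable Cf.
have ddf w w' y : O y -> derivable ('D_w f) y w' by exact: Ck_derivable (Cw w).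
pose r u v (t : R) := f (x + t *: u + t *: v) - f (x + t *: u) - (f (x + t *: v) - f x).
have rC t : r u v t = r v u t.
  by rewrite /r (addrAC x (t *: u)); ring.
(* The rectangle is symmetric in the two directions, so one limit statement, used in both orders,
   gives the equality by uniqueness of the limit. *)
suff mixed u' v' : t^-1 ^+ 2 * r u' v' t @[t --> (0 : R)^'] --> 'D_u' ('D_v' f) x.
  have h := mixed v u.
  rewrite (_ : (fun t => _ * r v u t) = (fun t => t^-1 ^+ 2 * r u v t)) in h.
    exact: (@norm_cvg_unique R R^o _ _ _ _ (mixed u v) h).
  by apply/funext => t; rewrite rC.
move: u' v' {rC} => {}u {}v.
apply/(@cvgrPdist_lt _ R^o) => e e0.
have nN : \forall y \near x, O y /\ `|'D_u ('D_v f) x - 'D_u ('D_v f) y| < e.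
  near=> y; split; first by near: y; exact: open_nbhs_nbhs.
  near: y; move: e e0; apply/(@cvgrPdist_lt _ R^o).
  exact: Ck_continuous (Ck_derive u (Cw v)) Ox.
have [d d0 dN] := nbhs_norm_ball nN.
have uv0 : 0 < `|u| + `|v| + 1 by rewrite ltr_wpDl// addr_ge0.
near=> t.
have t0 : t != 0 by near: t; exact: nbhs_dnbhs_neq.
have td : `|t| * (`|u| + `|v| + 1) < d.
  rewrite -ltr_pdivlMr//; near: t; apply: nbhs_dnbhs; apply/nbhs_normP.
  exists (d / (`|u| + `|v| + 1)); first by rewrite /= divr_gt0.
  by move=> t /=; rewrite sub0r normrN.
have Nt (a b : R) : 0 <= a <= 1 -> 0 <= b <= 1 ->
    O (x + a *: (t *: u) + b *: (t *: v)) /\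
    `|'D_u ('D_v f) x - 'D_u ('D_v f) (x + a *: (t *: u) + b *: (t *: v))| < e.
  move=> /andP[a0 a1] /andP[b0 b1]; apply: dN.
  rewrite -(addrA x) (addrC x) addrK; apply: le_lt_trans td.
  rewrite (le_trans (ler_normD _ _))// !normrZ (ger0_norm a0) (ger0_norm b0).
  rewrite -addrA mulrDr lerD//.
    by rewrite -[leRHS]mul1r ler_wpM2r// mulr_ge0.
  apply: (@le_trans _ _ (`|t| * `|v|)).
    by rewrite -[leRHS]mul1r ler_wpM2r// mulr_ge0.
  by rewrite ler_wpM2l// lerDl.
(* The rectangle is an increment of [g] along [t v]: the mean value theorem is applied to [g] in
   that direction, then to ['D_v f] along [t u]. *)
pose g y := f (y + t *: u) - f y.
have i01 (a : R) : 0 < a < 1 -> 0 <= a <= 1 by case/andP=> *; rewrite !ltW.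
have dg y w : O y -> O (y + t *: u) ->
    is_derive y w g ('D_w f (y + t *: u) - 'D_w f y).
  move=> Oy Oyu; apply: (@is_deriveB _ _ _ (fun y => f (y + t *: u))).
    have := derivableP (df w _ Oyu) => /is_derive_line0P h; apply/is_derive_line0P.
    by under eq_fun => z do rewrite addrAC.
  exact/derivableP/df.
have O1 (b : R) : 0 <= b <= 1 -> O (x + b *: (t *: v)).
  move=> b01; have [|//|] := @Nt 0 b; first by rewrite lexx ler01.
  by rewrite scale0r addr0.
have O2 (b : R) : 0 <= b <= 1 -> O (x + b *: (t *: v) + t *: u).
  move=> b01; have [|//|] := @Nt 1 b; first by rewrite lexx ler01.
  by rewrite scale1r addrAC.
have [b b01 E1] : exists2 b : R, 0 < b < 1 &
    g (x + t *: v) - g x = 'D_(t *: v) g (x + b *: (t *: v)).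
  apply: MVT_line => b b01.
  by have [] := is_deriveZv t (dg _ v (O1 _ b01) (O2 _ b01)).
have {}b01 := i01 _ b01.
have [a a01 E2] : exists2 a : R, 0 < a < 1 &
    'D_v f (x + b *: (t *: v) + t *: u) - 'D_v f (x + b *: (t *: v)) =
    'D_(t *: u) ('D_v f) (x + b *: (t *: v) + a *: (t *: u)).
  apply: (@MVT_line _ _ ('D_v f) (x + b *: (t *: v)) (t *: u)) => a a01.
  have [Oab _] := Nt a b a01 b01.
  rewrite addrAC in Oab.
  by have [] := is_deriveZv t (derivableP (ddf v u _ Oab)).
have {}a01 := i01 _ a01.
have [Oab lte] := Nt a b a01 b01.
suff -> : t^-1 ^+ 2 * r u v t = 'D_u ('D_v f) (x + a *: (t *: u) + b *: (t *: v)) by [].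
have -> : r u v t = g (x + t *: v) - g x by rewrite /r /g (addrAC x (t *: u)); ring.
have [_ dgE] := is_deriveZv t (dg _ v (O1 _ b01) (O2 _ b01)).
rewrite (addrAC x (a *: (t *: u))) in Oab *.
rewrite E1 dgE E2 deriveZv; last exact: ddf.
move: ('D_u ('D_v f) _) => z.
by field.
Unshelve. all: by end_near. Qed.
End C1.

(** * The chain rule for maps into R^m *)

Lemma cvgr_sum (R : realType) (T : Type) (F : set_system T) (FF : Filter F)
    (I : finType) (f : I -> T -> R) (l : I -> R) :
  (forall i, f i x @[x --> F] --> l i) ->
  (\sum_i f i x) @[x --> F] --> \sum_i l i.
Proof.
move=> fl; elim: index_enum => [|i s IH].
  by under eq_fun do rewrite big_nil; rewrite big_nil; exact: cvg_cst.
by under eq_fun do rewrite big_cons; rewrite big_cons; exact: cvgD.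
Qed.

Section ChainRule.
Context {R : realType} {W : normedModType R} {m : nat}.

Lemma C1_derive_row (U : set 'rV[R]_m) (f : 'rV[R]_m -> R) y v :
  open U -> Ck 1 U f -> U y -> 'D_v f y = \sum_i v 0 i * 'D_'e_i f y.
Proof.
move=> oU Cf Uy; rewrite {1}(row_sum_delta v) (C1_derive_sum _ oU Cf Uy).
by apply: eq_bigr => i _; rewrite deriveZv//; exact: Ck_derivable Cf Uy.
Qed.

(** The increment [c t - c 0] has no fixed direction. The mean value theorem on the segment between
    these two points, with the direction expanded in the standard basis, writes the quotient as a
    sum of coordinate quotients of [c], which tend to [d i], times partial derivatives of [f] at
    intermediate points, which converge by continuity. *)
Lemma is_derive_comp_row (U : set 'rV[R]_m) (f : 'rV[R]_m -> R)
    (g : W -> 'rV[R]_m) x v (d : 'I_m -> R) :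
  open U -> Ck 1 U f -> U (g x) ->
  (forall i, is_derive x v (fun y => g y 0 i) (d i)) ->
  is_derive x v (f \o g) (\sum_i d i * 'D_'e_i f (g x)).
Proof.
move=> oU Cf Ugx dg; apply/is_derive_line0P.
pose c (t : R) := g (x + t *: v).
have c0 : c 0 = g x by rewrite /c scale0r addr0.
have dc i : is_derive (0 : R) 1 (fun t => c t 0 i) (d i) by apply/is_derive_line0P.
have cc : {for (0 : R), continuous c}.
  apply: differentiable_continuous; apply/derivable1_diffP/derivable_mxP => i j.
  by rewrite (ord1 i); have [] := dc j.
have [e e0 eU] := nbhs_norm_ball (open_nbhs_nbhs (conj oU Ugx)).
(* The intermediate parameter is chosen as a function of [t], so that its limit can be taken; when
   [c t] lies outside the ball, [s t = 0] is a mere default. *)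
have /choice[s sP] (t : R) : exists s : R, 0 <= s <= 1 /\ (`|c t - c 0| < e ->
    f (c t) - f (c 0) =
    \sum_i (c t 0 i - c 0 0 i) * 'D_'e_i f (c 0 + s *: (c t - c 0))).
  have [cte|] := boolP (`|c t - c 0| < e); last by exists 0; rewrite lexx ler01.
  have Us (s : R) : 0 <= s <= 1 -> U (c 0 + s *: (c t - c 0)).
    move=> /andP[s0 s1]; apply: eU; rewrite c0 [_ + s *: _]addrC addrK -c0.
    by rewrite normrZ ger0_norm// (le_lt_trans _ cte)// ler_piMl.
  have [|s s01] := @MVT_line R _ f (c 0) (c t - c 0).
    by move=> s s01; exact: Ck_derivable Cf (Us s s01).
  rewrite [c 0 + _]addrC subrK => E.
  have {}s01 : 0 <= s <= 1 by case/andP: s01 => *; rewrite !ltW.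
  exists s; split=> // _; rewrite E (C1_derive_row _ oU Cf) => [|]; last exact: Us.
  by apply: eq_bigr => i _; rewrite !mxE.
pose p t := c 0 + s t *: (c t - c 0).
have pc : p t @[t --> (0 : R)] --> c 0.
  apply/cvgrPdist_lt => r r0; near=> t.
  rewrite /p distrC [c 0 + _]addrC addrK normrZ.
  have [/andP[s0 s1] _] := sP t; rewrite ger0_norm//.
  have : `|c t - c 0| < r.
    by rewrite distrC; near: t; move: r r0; apply/cvgrPdist_lt.
  by apply: le_lt_trans; rewrite ler_piMl.
have dfp i : 'D_'e_i f (p t) @[t --> (0 : R)^'] --> 'D_'e_i f (g x).
  rewrite -c0; apply: cvg_within_filter; apply: (cvg_comp p ('D_'e_i f) pc).
  by rewrite c0; exact: Ck_continuous (Ck_derive 'e_i Cf) Ugx.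
have dq i : t^-1 * (c t 0 i - c 0 0 i) @[t --> (0 : R)^'] --> d i.
  have [+ <-] := dc i; rewrite /derivable /derive.
  rewrite (_ : (fun h : R => _) = (fun t : R => t^-1 * (c t 0 i - c 0 0 i)))//.
  by apply/funext => h /=; rewrite addr0 -[h *: 1]/(h * 1) mulr1.
have lim : t^-1 *: (f (c t) - f (c 0)) @[t --> (0 : R)^'] -->
    \sum_i d i * 'D_'e_i f (g x).
  have H : \sum_i (t^-1 * (c t 0 i - c 0 0 i)) * 'D_'e_i f (p t)
      @[t --> (0 : R)^'] --> \sum_i d i * 'D_'e_i f (g x).
    by apply: cvgr_sum => i; apply: cvgM.
  apply: cvg_trans H; apply: near_eq_cvg; near=> t.
  have [_ ->] := sP t.
    by rewrite -[_ *: _]/(_ * _) mulr_sumr; apply: eq_bigr => i _; rewrite -mulrA.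
  near: t; apply: nbhs_dnbhs; have /cvgrPdist_lt/(_ _ e0) := cc.
  by apply: filterS => t; rewrite distrC.
have E : (fun h : R => h^-1 *: ((fun t => f (c t)) (h *: 1 + 0) - (fun t => f (c t)) 0)) =
   (fun t => t^-1 *: (f (c t) - f (c 0))).
  by apply/funext => h /=; rewrite addr0 -[h *: 1]/(h * 1) mulr1.
split; first by apply/cvg_ex; eexists; rewrite E; exact: lim.
by rewrite /derive E; apply: (cvg_lim _ lim).
Unshelve. all: by end_near. Qed.
End ChainRule.

(** * Functions of class C^k *)

Section CkTheory.
Context {R : realType} {V W : normedModType R}.

Lemma Ck_local k (O : set V) (f : V -> R) :
  (forall x, O x -> exists N, [/\ open N, N x & Ck k N f]) -> Ck k O f.
Proof.
elim: k f => [|k IH] f loc.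
all: have cf x : O x -> {for x, continuous f}
  by move=> /loc[N [_ Nx CN]]; exact: Ck_continuous CN Nx.
  by split.
split=> // v; split=> [x /loc[N [_ Nx CN]]|]; first exact: Ck_derivable CN Nx.
apply: IH => x /loc[N [oN Nx CN]]; exists N; split=> //; exact: Ck_derive.
Qed.

Lemma Ck_le k l (O : set V) (f : V -> R) : (k <= l)%N -> Ck l O f -> Ck k O f.
Proof.
move=> /subnK <-; elim: (l - k)%N => // d IH; rewrite addSn => /Ck_pred; exact: IH.
Qed.

Lemma Ck_affine k (O : set V) (f l : V -> R) : open O -> continuous f ->
  (forall x v t, f (x + t *: v) = f x + t * l v) -> Ck k O f.
Proof.
move=> oO cf fl.
have df x v : is_derive x v f (l v).
  apply/is_derive_line0P; under eq_fun do rewrite fl.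
  exact: is_derive_affine.
case: k => [|k]; first by split=> // x _; exact: cf.
split=> [x _|v]; [exact: cf|split=> [x _|]].
  by have [] := df x v.
by apply: Ck_eq (Ck_cst k (l v) oO) => // x _; have [] := df x v.
Qed.

(** Affine maps send lines to lines, so the derivative along [v] is that of [f] along [l v], again
    composed with the same [L]: the induction closes without the general chain rule. *)
Lemma Ck_comp_affine k (L l : W -> V) (U : set V) (O : set W) (f : V -> R) :
  open O -> continuous L -> (forall x v t, L (x + t *: v) = L x + t *: l v) ->
  (forall x, O x -> U (L x)) -> Ck k U f -> Ck k O (f \o L).
Proof.
move=> oO cL Ll OU; elim: k f => [|k IH] f Cf.
all: have c x : O x -> {for x, continuous (f \o L)}
  by move=> /OU Ux; apply: continuous_comp; [exact: cL|exact: Ck_continuous Cf Ux].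
  by split.
have d x v : O x -> is_derive x v (f \o L) ('D_(l v) f (L x)).
  move=> /OU Ux; have := derivableP (Ck_derivable (v := l v) Cf Ux).
  by move=> /is_derive_line0P h; apply/is_derive_line0P; under eq_fun do rewrite /= Ll.
split=> // v; split=> [x Ox|]; first by have [] := d x v Ox.
apply: Ck_eq (IH _ (Ck_derive (l v) Cf)) => // x Ox.
by have [_ ->] := d x v Ox.
Qed.

Lemma Ck_sum k (O : set V) (I : finType) (F : I -> V -> R) : open O ->
  (forall i, Ck k O (F i)) -> Ck k O (\sum_i F i).
Proof.
move=> oO CF; apply: (big_ind (Ck k O)) => //; first exact: (Ck_cst k 0 oO).
by move=> f g; exact: Ck_add.
Qed.

Lemma Ck_prod k (O : set V) (I : finType) (F : I -> V -> R) : open O ->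
  (forall i, Ck k O (F i)) -> Ck k O (\prod_i F i).
Proof.
move=> oO CF; apply: (big_ind (Ck k O)) => //; first exact: (Ck_cst k 1 oO).
by move=> f g; exact: Ck_mul.
Qed.

Lemma Ck_comp_real k (f : R -> R) (U : set R) (O : set V) (g : V -> R) :
  open O -> Ck k U f -> Ck k O g -> (forall x, O x -> U (g x)) ->
  Ck k O (f \o g).
Proof.
move=> oO + + OU; elim: k f => [|k IH] f Cf Cg.
all: have c x : O x -> {for x, continuous (f \o g)}
  by move=> Ox; apply: continuous_comp;
     [exact: Ck_continuous Cg Ox|exact: Ck_continuous Cf (OU _ Ox)].
  by split.
have d x v : O x -> is_derive x v (f \o g) ('D_1 f (g x) * 'D_v g x).
  move=> Ox; have := derivableP (Ck_derivable (v := v) Cg Ox).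
  move=> /is_derive_line0P h; apply/is_derive_line0P.
  apply: (@is_derive1_comp _ f (fun t => g (x + t *: v))).
  rewrite scale0r addr0; apply/derivableP; exact: Ck_derivable Cf (OU _ Ox).
split=> // v; split=> [x Ox|]; first by have [] := d x v Ox.
have H := Ck_mul oO (IH _ (Ck_derive (1 : R) Cf) (Ck_pred Cg)) (Ck_derive v Cg).
apply: (Ck_eq oO _ H) => x Ox.
by have [_ ->] := d x v Ox.
Qed.
End CkTheory.

Lemma Ck_comp_row (R : realType) (W : normedModType R) m k (f : 'rV[R]_m -> R)
    (U : set 'rV[R]_m) (O : set W) (g : W -> 'rV[R]_m) :
  open O -> open U -> Ck k U f -> (forall i, Ck k O (fun x => g x 0 i)) ->
  (forall x, O x -> {for x, continuous g}) -> (forall x, O x -> U (g x)) ->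
  Ck k O (f \o g).
Proof.
move=> oO oU + + cg OU; elim: k f => [|k IH] f Cf Cg.
all: have c x : O x -> {for x, continuous (f \o g)}
  by move=> Ox; apply: continuous_comp; [exact: cg|exact: Ck_continuous Cf (OU _ Ox)].
  by split.
have d x v : O x -> is_derive x v (f \o g)
    (\sum_i 'D_v (fun y => g y 0 i) x * 'D_'e_i f (g x)).
  move=> Ox; apply: (is_derive_comp_row oU (Ck_le _ Cf)) => //; first exact: OU.
  by move=> i; apply/derivableP; exact: Ck_derivable (Cg i) Ox.
split=> // v; split=> [x Ox|]; first by have [] := d x v Ox.
have := Ck_sum oO (fun i => Ck_mul oO (Ck_derive v (Cg i))
  (IH _ (Ck_derive 'e_i Cf) (fun j => Ck_pred (Cg j)))).
apply: Ck_eq => // x Ox.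
by rewrite fct_sumE; have [_ ->] := d x v Ox.
Qed.

Lemma Ck_coord (R : realType) m d k (O : set 'M[R]_(m, d)) i j :
  open O -> Ck k O (fun x => x i j).
Proof.
move=> oO; apply: (@Ck_affine R 'M[R]_(m, d) k O _ (fun v => v i j)) => // [|x v t].
  by move=> x; exact: coord_continuous.
by rewrite !mxE.
Qed.

(** * Bump functions *)

Section FlatFunction.
Context {R : realType}.

(** The negative powers [t^-m] are included because the span of the family is closed under
    differentiation: [flat m] has derivative [flat m.+2 - m flat m.+1]. *)
Definition flat (m : nat) (t : R) : R :=
  if 0 < t then t^-1 ^+ m * expR (- t^-1) else 0.

Lemma flat_ge0 m t : 0 <= flat m t.
Proof.
by rewrite /flat; case: ifP => // t0; rewrite mulr_ge0 ?exprn_ge0 ?invr_ge0 ?expR_ge0 ?ltW.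
Qed.

Lemma flat_le0 m t : t <= 0 -> flat m t = 0.
Proof. by rewrite /flat leNgt => /negbTE ->. Qed.

Lemma flat0_gt0 t : 0 < t -> 0 < flat 0 t.
Proof. by rewrite /flat => ->; rewrite expr0 mul1r expR_gt0. Qed.

(** With [s = 1/t], the inequality [1 + x <= exp x] at [x = s/(m+1)], raised to the power [m+1],
    bounds [s^(m+1)] by a constant times [exp s]. After [s^m] has been absorbed one power of [s] is
    left, hence the factor [t]; this gives the limit 0 at the origin for every [m]. *)
Lemma flat_bound m t : flat m t <= (m.+1)%:R ^+ m.+1 * `|t|.
Proof.
have [t0|t0] := ltP 0 t; last by rewrite flat_le0// mulr_ge0// exprn_ge0.
rewrite /flat t0 gtr0_norm//.
have N0 : 0 < m.+1%:R :> R by [].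
have h : (t^-1 / m.+1%:R) ^+ m.+1 <= expR t^-1.
  have -> : expR t^-1 = expR (t^-1 / m.+1%:R) ^+ m.+1.
    by rewrite -expRM_natl mulrC divfK// lt0r_neq0.
  rewrite lerXn2r//.
  - by rewrite nnegrE divr_ge0// invr_ge0 ltW.
  - by rewrite nnegrE expR_ge0.
  - by apply: le_trans (expR_ge1Dx _); rewrite lerDr.
rewrite expRN ler_pdivrMr ?expR_gt0//.
apply: le_trans (ler_wpM2l _ h); last by rewrite mulr_ge0// ?exprn_ge0// ltW.
rewrite exprMn (exprVn m.+1%:R) (exprS t^-1); set w := _ ^+ m.+1.
have w0 : w != 0 by rewrite expf_neq0// lt0r_neq0.
rewrite le_eqVlt; apply/orP; left; apply/eqP; field.
by rewrite w0 lt0r_neq0.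
Qed.

Lemma is_derive_flat m (t : R) :
  is_derive t 1 (flat m) (flat m.+2 t - m%:R * flat m.+1 t).
Proof.
have [t0|t0|<-] := ltgtP 0 t.
- have nt : t != 0 by rewrite lt0r_neq0.
  have : is_derive t 1 (fun t => t^-1 ^+ m * expR (- t^-1))
      (flat m.+2 t - m%:R * flat m.+1 t).
    pose u (y : R) := y^-1.
    have du : is_derive t 1 u (- t ^- 2).
      by apply: is_derive_eq (is_deriveV nt (is_derive_id t 1)) _; exact: mulr1.
    have de := is_derive1_comp (is_derive_expR _) (is_deriveN du).
    rewrite (_ : (fun t : R => _) = u ^+ m * (expR \o (- u))); last first.
      by apply/funext => y; rewrite mulrfctE exprfctE.
    apply: is_derive_eq (is_deriveM (is_deriveX m du) de) _.
    rewrite /flat t0 exprfctE /= opprfctE /u /GRing.scale /= opprK.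
    rewrite -!exprVn; case: m => [|m] /=; first by ring.
    by rewrite !exprS; ring.
  apply: near_eq_is_derive; near=> s.
  by rewrite /flat ifT//; near: s; exact: lt_nbhsr.
- rewrite !flat_le0 ?ltW// mulr0 subr0.
  apply: near_eq_is_derive (is_derive_cst (0 : R) t 1); near=> s.
  by rewrite flat_le0// ltW//; near: s; exact: lt_nbhsl.
rewrite !flat_le0// mulr0 subr0.
have lim : h^-1 *: (flat m (h *: 1 + 0) - flat m 0) @[h --> (0 : R)^'] --> (0 : R).
  (* At the origin the difference quotient of [flat m] is [flat m.+1] itself, which tends to 0 by
     [flat_bound]. *)
  rewrite (_ : (fun h : R => _) = flat m.+1); last first.
    apply/funext => h; rewrite addr0 -[h *: 1]/(h * 1) mulr1 (flat_le0 _ (lexx 0)) subr0.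
    rewrite /flat; case: ifP => _; last exact: scaler0.
    by rewrite -[_ *: _]/(_ * _) exprS mulrA.
  apply: cvg_within_filter; apply/cvgrPdist_lt => e e0; near=> h.
  rewrite sub0r normrN ger0_norm ?flat_ge0// (le_lt_trans (flat_bound _ _))//.
  rewrite mulrC -ltr_pdivlMr ?exprn_gt0//.
  near: h; apply/nbhs_normP; exists (e / m.+2%:R ^+ m.+2).
    by rewrite /= divr_gt0// exprn_gt0.
  by move=> y /=; rewrite sub0r normrN.
split; first by apply/cvg_ex; eexists; exact: lim.
exact: (cvg_lim _ lim).
Unshelve. all: by end_near. Qed.

Lemma continuous_flat m : continuous (flat m).
Proof.
move=> t; apply: differentiable_continuous; apply/derivable1_diffP.
by have [] := is_derive_flat m t.
Qed.

Lemma Ck_flat k m (O : set R) : open O -> Ck k O (flat m).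
Proof.
move=> oO; elim: k m => [|k IH] m; split=> //; try by move=> *; exact: continuous_flat.
move=> v; have d t : is_derive t v (flat m) (v * (flat m.+2 t - m%:R * flat m.+1 t)).
  by have := is_deriveZv v (is_derive_flat m t); rewrite -[v *: 1]/(v * 1) mulr1.
split=> [t _|]; first by have [] := d t.
have := Ck_mul oO (Ck_cst k v oO)
  (Ck_add oO (IH m.+2) (Ck_mul oO (Ck_cst k (- m%:R) oO) (IH m.+1))).
apply: (Ck_eq oO) => t _; have [_ ->] := d t.
by rewrite !fctE mulNr.
Qed.
End FlatFunction.

Section Bump.
Context {R : realType}.

Lemma Ck_inv k : Ck k [set t : R | 0 < t] GRing.inv.
Proof.
have oP : open [set t : R | 0 < t] by exact: open_gt.
have d (t v : R) : 0 < t -> is_derive t v GRing.inv (- v * (t^-1 * t^-1)).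
  move=> t0; have nt : t != 0 by rewrite lt0r_neq0.
  apply: is_derive_eq (is_deriveV nt (is_derive_id t v)) _.
  by rewrite /GRing.scale /= expr2 invfM; ring.
have c (t : R) : 0 < t -> {for t, continuous (GRing.inv : R -> R)}.
  by move=> t0; apply: inv_continuous; rewrite lt0r_neq0.
elim: k => [|k IH]; split=> // v; split=> [t /(d _ v)[]//|].
have := Ck_mul oP (Ck_cst k (- v) oP) (Ck_mul oP IH IH).
by apply: (Ck_eq oP) => t t0; have [_ ->] := d t v t0.
Qed.

Definition smooth_step (s : R) : R := flat 0 s / (flat 0 s + flat 0 (1 - s)).

Lemma smooth_step0 s : s <= 0 -> smooth_step s = 0.
Proof. by move=> s0; rewrite /smooth_step flat_le0// mul0r. Qed.

Lemma smooth_step1 s : 1 <= s -> smooth_step s = 1.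
Proof.
move=> s1; rewrite /smooth_step (@flat_le0 _ _ (1 - s)) ?subr_le0// addr0 divff//.
by rewrite lt0r_neq0// flat0_gt0// (lt_le_trans ltr01).
Qed.

Lemma Ck_smooth_step k : Ck k setT smooth_step.
Proof.
have oT : open [set: R] by exact: openT.
have C1 : Ck k setT (flat 0 : R -> R) by exact: Ck_flat.
have C2 : Ck k setT (flat 0 \o (fun s : R => 1 - s)).
  apply: (Ck_comp_affine (l := fun v => - v) (U := setT)) => // [x|x v t].
    by apply: cvgB; [exact: cvg_cst|exact: cvg_id].
  by rewrite scalerN opprD addrA.
have := Ck_mul oT C1 (Ck_comp_real (U := [set t : R | 0 < t]) oT (Ck_inv k) (Ck_add oT C1 C2) _).
apply => s _ /=; rewrite !fctE /=.
have [s0|s0] := ltP 0 s; first by rewrite ltr_pwDl ?flat0_gt0 ?flat_ge0.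
by rewrite ltr_wpDl ?flat_ge0// flat0_gt0//; lra.
Qed.

Lemma mx_norm_ge_coord m d (x : 'M[R]_(m, d)) i j : `|x i j| <= `|x|.
Proof.
rewrite [leRHS](_ : _ = mx_norm x)// mx_normrE.
exact: (le_bigmax _ (fun ij => `|x ij.1 ij.2|) (i, j)).
Qed.

Lemma mx_norm_lt m d (x : 'M[R]_(m, d)) e : 0 < e ->
  (forall i j, `|x i j| < e) -> `|x| < e.
Proof.
by move=> e0 xe; rewrite [ltLHS](_ : _ = mx_norm x)// mx_normrE; apply/bigmax_ltP; split=> // -[].
Qed.

(** The norm is the sup norm, so a product over the coordinates suffices. With [h] the rescaled
    coordinate, [2 - h^2] is at least 1 when [|h| <= 1] and negative when [|h| >= 2]; squaring
    avoids the absolute value, which is not smooth. *)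
Lemma row_bump n (a : 'rV[R]_n) (r : R) : 0 < r ->
  exists b : 'rV[R]_n -> R, [/\ forall k, Ck k setT b,
    forall y, `|y - a| < r -> b y = 1 & forall y, 2 * r <= `|y - a| -> b y = 0].
Proof.
move=> r0; have oT : open [set: 'rV[R]_n] by exact: openT.
pose h (i : 'I_n) (y : 'rV[R]_n) := r^-1 * (y 0 i - a 0 i).
pose b (y : 'rV[R]_n) := \prod_i smooth_step (2 - h i y ^+ 2).
have Ch k i : Ck k setT (h i).
  have H := Ck_mul oT (Ck_cst k r^-1 oT)
    (Ck_add oT (Ck_coord k 0 i oT) (Ck_cst k (- a 0 i) oT)).
  exact: Ck_eq oT _ H.
have hr i y : `|h i y| = r^-1 * `|y 0 i - a 0 i|.
  by rewrite normrM gtr0_norm// invr_gt0.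
exists b; split=> [k|y yr|y].
- rewrite (_ : b = \prod_i (smooth_step \o (cst 2 + cst (-1) * (h i * h i)))); last first.
    by apply/funext => y; rewrite fct_prodE; apply: eq_bigr => i _; rewrite /= !fctE expr2 mulN1r.
  apply: Ck_prod => // i; apply: (Ck_comp_real (U := setT)) => //; first exact: Ck_smooth_step.
  by apply: Ck_add => //; [exact: Ck_cst|do 2 ?apply: Ck_mul => //; exact: Ck_cst].
- rewrite /b big1// => i _; apply: smooth_step1.
  have : `|h i y| <= 1.
    rewrite hr ler_pdivrMl// mulr1 (le_trans _ (ltW yr))//.
    by have := mx_norm_ge_coord (y - a) 0 i; rewrite !mxE.
  have := normr_ge0 (h i y); rewrite -(real_normK (num_real (h i y))).
  by move: `|h i y| => c c0 c1; nra.
move=> yr; have [i hi] : exists i, 2 * r <= `|y 0 i - a 0 i|.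
  apply: contrapT => /forallNP hN; move: yr; apply/negP; rewrite -ltNge.
  apply: mx_norm_lt => [|j i]; first by rewrite mulr_gt0.
  by rewrite (ord1 j) !mxE ltNge; apply/negP/hN.
rewrite /b (bigD1 i)//= smooth_step0 ?mul0r//.
have : 2 <= `|h i y| by rewrite hr ler_pdivlMl// mulrC.
rewrite -(real_normK (num_real (h i y))).
by move: `|h i y| => c c2; nra.
Qed.
End Bump.

(** * Hadamard's lemma *)

Lemma continuous_normP (R : realType) (V : normedModType R) (f : V -> R) x :
  (forall e : R, 0 < e -> exists2 d : R, 0 < d &
    forall y, `|y - x| < d -> `|f y - f x| < e) -> {for x, continuous f}.
Proof.
move=> fP; apply/cvgrPdist_lt => e /fP[d d0 dP]; apply/nbhs_normP.
by exists d => // y /=; rewrite distrC => /dP; rewrite distrC.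
Qed.

Section Hadamard.
Context {R : realType} {n : nat}.
Implicit Types (a y v : 'rV[R]_n) (U : set 'rV[R]_n).

Lemma continuous_dist a : continuous (fun y => `|y - a|).
Proof.
move=> y; have h : {for y, continuous (fun y => y - a)}.
  by apply: continuousB => //; exact: cst_continuous.
by apply: (continuous_comp h); exact: norm_continuous.
Qed.

Lemma compact_box a (r : R) : compact [set y | `|y - a| <= r].
Proof.
apply: bounded_closed_compact.
  exists (`|a| + r); split; first exact: num_real.
  move=> M aM y /= yr; rewrite (le_trans _ (ltW aM))//.
  by rewrite -[y](subrK a) addrC (le_trans (ler_normD _ _))// lerD2l.
have -> : [set y | `|y - a| <= r] = (fun y => `|y - a|) @^-1` [set x | x <= r] by [].
apply: closed_comp => [y _|]; last exact: closed_le.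
exact: continuous_dist.
Qed.

Lemma box_bounded U (f : 'rV[R]_n -> R) a (r : R) : Ck 0 U f ->
  (forall y, `|y - a| <= r -> U y) ->
  exists2 C, 0 <= C & forall y, `|y - a| <= r -> `|f y| <= C.
Proof.
move=> [cf _] aU.
have : bounded_set (f @` [set y | `|y - a| <= r]).
  apply: compact_bounded; apply: continuous_compact; last exact: compact_box.
  by apply: continuous_in_subspaceT => y /set_mem /aU; exact: cf.
move=> /ex_strict_bound_gt0[C C0 fC]; exists C; first exact: ltW.
by move=> y yr; apply/ltW/fC; exists y.
Qed.

Definition unit_integral (phi : R -> R) : R := \int[lebesgue_measure]_(t in `[0, 1]) phi t.

Lemma unit_integrable (phi : R -> R) : {within `[0, 1], continuous phi} ->
  lebesgue_measure.-integrable `[0, 1] (EFin \o phi).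
Proof. by move=> c; apply: continuous_compact_integrable => //; exact: segment_compact. Qed.

Lemma unit_integral_sum (I : finType) (c : I -> R) (phi : I -> R -> R) :
  (forall i, {within `[0, 1], continuous (phi i)}) ->
  unit_integral (fun t => \sum_i c i * phi i t) = \sum_i c i * unit_integral (phi i).
Proof.
move=> cphi; have m01 := measurable_itv `[(0 : R), 1].
have cZ i : {within `[0, 1], continuous (fun t => c i * phi i t)}.
  move=> t; apply: continuousM.
    exact: cst_continuous.
  exact: cphi.
suff [] : {within `[0, 1], continuous (fun t => \sum_i c i * phi i t)} /\
  unit_integral (fun t => \sum_i c i * phi i t) = \sum_i c i * unit_integral (phi i) by [].
elim: index_enum => [|i s [cs IH]].
  have -> : (fun t : R => \sum_(i <- [::]) c i * phi i t) = cst 0.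
    by apply/funext => t; rewrite big_nil.
  split; first by apply: continuous_subspaceT; exact: cst_continuous.
  by rewrite big_nil /unit_integral Rintegral_cst ?mul0r.
have -> : (fun t : R => \sum_(j <- i :: s) c j * phi j t) =
    (fun t => c i * phi i t) + (fun t => \sum_(j <- s) c j * phi j t).
  by apply/funext => t; rewrite big_cons.
split; first by move=> t; apply: continuousD; [exact: cZ|exact: cs].
rewrite big_cons -IH /unit_integral RintegralD//; [|exact: unit_integrable..].
by rewrite RintegralZl//; exact: unit_integrable.
Qed.

Lemma unit_integral_bound (phi : R -> R) (C : R) : {within `[0, 1], continuous phi} ->
  (forall t, 0 <= t <= 1 -> `|phi t| <= C) -> `|unit_integral phi| <= C.
Proof.
move=> c phiC; have ip := unit_integrable c.
have mu01 : fine (lebesgue_measure `[(0 : R), 1]) = 1.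
  by rewrite lebesgue_measure_itv/= lte_fin ltr01 oppr0 adde0.
apply: le_trans (le_normr_Rintegral _ ip) _; first exact: measurable_itv.
have -> : C = \int[lebesgue_measure]_(t in `[0, 1]) C.
  by rewrite Rintegral_cst ?mu01 ?mulr1//; exact: measurable_itv.
apply: le_Rintegral; first exact: measurable_itv.
- by apply: unit_integrable => t; apply: continuous_comp (c t) _; exact: norm_continuous.
- by apply: unit_integrable; apply: continuous_subspaceT; exact: cst_continuous.
- by move=> t /=; rewrite in_itv/=; exact: phiC.
Qed.

Lemma norm_monomial_le (t c C : R) m : 0 <= t <= 1 -> `|c| <= C -> `|t ^+ m * c| <= C.
Proof.
move=> /andP[t0 t1] cC; rewrite normrM (ger0_norm (exprn_ge0 _ t0)).
by rewrite (le_trans _ cC)// ler_piMl// exprn_ile1.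
Qed.

(** For [m = 0] and [f] a partial derivative these are the coefficients of Hadamard's lemma. The
    weight [t ^+ m] is there because differentiating in [y] under the integral produces one more
    factor [t]. *)
Definition ray_moment a (m : nat) (f : 'rV[R]_n -> R) y : R :=
  unit_integral (fun t => t ^+ m * f (a + t *: (y - a))).

Section Ball.
Variables (U : set 'rV[R]_n) (a : 'rV[R]_n) (r : R).
Hypotheses (oU : open U) (aU : forall y, `|y - a| <= r -> U y).

Let B : set 'rV[R]_n := [set y | `|y - a| < r].

Lemma ball_ray y (t : R) : B y -> 0 <= t <= 1 -> `|a + t *: (y - a) - a| <= r.
Proof.
rewrite /B/= [a + _]addrC addrK normrZ => yr /andP[t0 t1]; rewrite ger0_norm//.
by rewrite (le_trans _ (ltW yr))// ler_piMl.
Qed.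

Lemma continuous_ray m f y : Ck 1 U f -> B y ->
  {within `[0, 1], continuous (fun t : R => t ^+ m * f (a + t *: (y - a)))}.
Proof.
move=> Cf By; apply: derivable_within_continuous => t; rewrite in_itv/= => t01.
apply: derivableM; first exact: exprn_derivable.
have := derivableP (Ck_derivable (v := y - a) Cf (aU (ball_ray By t01))).
by move=> /is_derive_lineP[].
Qed.

Lemma open_ball_set : open B.
Proof.
rewrite (_ : B = (fun y => `|y - a|) @^-1` [set x | x < r])//.
apply: open_comp => [y _|]; last exact: open_lt.
exact: continuous_dist.
Qed.

Lemma is_derive_ray_moment m f y v : Ck 2 U f -> B y ->
  is_derive y v (ray_moment a m f) (ray_moment a m.+1 ('D_v f) y).
Proof.
move=> Cf By; have Cf1 := Ck_pred Cf.
(* [C] bounds ['D_v f] on the compact closed ball; as powers of [t] are at most 1 on the unit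
   interval, the constant [C] dominates the derivative of the integrand. *)
have [C C0 fC] := box_bounded (Ck_pred (Ck_derive v Cf)) aU.
pose F (x t : R) := t ^+ m * f (a + t *: (y + x *: v - a)).
have nB : nbhs y B by apply: open_nbhs_nbhs; split => //; exact: open_ball_set.
have [e e0 eB] : exists2 e : R, 0 < e & forall x, `|x| < e -> B (y + x *: v).
  have := near0_segment 0 v nB => /nbhs_norm_ball[e e0 eP]; exists e => // x xe.
  have := eP x; rewrite subr0 => /(_ xe 1); rewrite scaler0 addr0 scale1r.
  by apply; rewrite ler01 lexx.
have Bx (x : R) : `](- e), e[%classic x -> B (y + x *: v).
  by rewrite /= in_itv/= -ltr_norml; exact: eB.
(* Moving [y] by [x v] moves the point of parameter [t] on the ray by [x t v], whence the extra
   factor [t]. *)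
have rayE (x t : R) : a + t *: (y + x *: v - a) = a + t *: (y - a) + x *: (t *: v).
  by rewrite (addrAC y) scalerDr addrA !scalerA (mulrC t).
have dF (x t : R) : `](- e), e[%classic x -> `[0, 1]%classic t ->
    is_derive x 1 (F ^~ t) (t ^+ m.+1 * 'D_v f (a + t *: (y + x *: v - a))).
  move=> /Bx Bxv; rewrite /= in_itv/= => t01.
  have := derivableP (Ck_derivable (v := v) Cf1 (aU (ball_ray Bxv t01))).
  move=> /(is_deriveZv t).
  rewrite rayE.
  move=> /is_derive_lineP d.
  have := is_deriveM (is_derive_cst (t ^+ m) x 1) d.
  rewrite scaler0 addr0 /GRing.scale /= mulrA -exprSr.
  rewrite (_ : cst _ * _ = F ^~ t) ?rayE//.
  by apply/funext => s; rewrite /F rayE.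
have int0 : `](- e), e[%classic (0 : R) by rewrite /= in_itv/= oppr_lt0 e0.
have iF (x : R) : `](- e), e[%classic x ->
    lebesgue_measure.-integrable `[(0 : R), 1] (EFin \o F x).
  by move=> /Bx Bxv; apply: unit_integrable; exact: continuous_ray.
have dF' (x t : R) : `](- e), e[%classic x -> `[0, 1]%classic t -> derivable (F ^~ t) x 1.
  by move=> xe t01; have [] := dF x t xe t01.
have iC : lebesgue_measure.-integrable `[(0 : R), 1] (EFin \o cst C).
  by apply: unit_integrable; apply: continuous_subspaceT; exact: cst_continuous.
have dFC (x t : R) : `](- e), e[%classic x -> `[0, 1]%classic t ->
    `|partial1of2 F x t| <= cst C t.
  move=> xe t01; rewrite partial1of2E; have [_ ->] := dF x t xe t01.
  move: t01; rewrite /= in_itv/= => t01; apply: norm_monomial_le => //.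
  by apply: fC; apply: ball_ray => //; exact: Bx.
have := @cvg_differentiation_under_integral R _ _ lebesgue_measure F _ (measurable_itv _)
  0 (- e) e int0 iF dF' (cst C) (fun=> C0) iC dFC.
have -> : \int[lebesgue_measure]_(t in `[0, 1]) partial1of2 F 0 t =
    ray_moment a m.+1 ('D_v f) y.
  apply: eq_Rintegral => t /set_mem t01.
  by rewrite partial1of2E; have [_ ->] := dF 0 t int0 t01; rewrite scale0r addr0.
move=> lim; apply/is_derive_line0P.
have E : (fun h : R => h^-1 *: ((fun t => ray_moment a m f (y + t *: v)) (h *: 1 + 0) -
      (fun t => ray_moment a m f (y + t *: v)) 0)) =
   (fun h => h^-1 *: ((fun x => \int[lebesgue_measure]_(t in `[0, 1]) F x t) (h + 0) -
      (fun x => \int[lebesgue_measure]_(t in `[0, 1]) F x t) 0)).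
  by apply/funext => h /=; rewrite -[h *: 1]/(h * 1) mulr1.
split; first by apply/cvg_ex; eexists; rewrite E; exact: lim.
by rewrite /derive E; apply: (cvg_lim _ lim).
Qed.

Lemma Ck_ray_moment k m f : (forall l, Ck l U f) -> Ck k B (ray_moment a m f).
Proof.
move=> Cf.
have dI g l y v : (forall l, Ck l U g) -> B y ->
    is_derive y v (ray_moment a l g) (ray_moment a l.+1 ('D_v g) y).
  by move=> Cg By; apply: is_derive_ray_moment.
(* Directional derivatives alone do not give continuity. By the mean value theorem the increment
   from [y] to [z] is at most [|z - y|] times the sum of the bounds [C i] of the partial derivatives
   of [g]; the 1 added in [S] makes it a legitimate divisor. *)
have cI g l : (forall l, Ck l U g) -> forall y, B y -> {for y, continuous (ray_moment a l g)}.
  move=> Cg y By.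
  have /choice[C CP] i : exists C, 0 <= C /\ forall z, `|z - a| <= r -> `|'D_'e_i g z| <= C.
    by have [C C0 gC] := box_bounded (Ck_derive 'e_i (Cg 1%N)) aU; exists C.
  pose S := \sum_i C i + 1.
  have S0 : 0 < S by rewrite ltr_wpDl// sumr_ge0// => i _; have [] := CP i.
  have nB : nbhs y B by apply: open_nbhs_nbhs; split => //; exact: open_ball_set.
  have [d d0 dB] := nbhs_norm_ball nB.
  apply: continuous_normP => e e0; exists (Num.min d (e / S)).
    by rewrite lt_min d0 divr_gt0.
  move=> z; rewrite lt_min ltr_pdivlMr// => /andP[zyd zye].
  have Bs (s : R) : 0 <= s <= 1 -> B (y + s *: (z - y)).
    move=> /andP[s0 s1]; apply: dB; rewrite [y + _]addrC addrK normrZ ger0_norm//.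
    by rewrite (le_lt_trans _ zyd)// ler_piMl.
  have [|s s01] := @MVT_line _ _ (ray_moment a l g) y (z - y).
    by move=> s /Bs Bs'; have [] := dI g l _ (z - y) Cg Bs'.
  rewrite [y + (z - y)]addrC subrK => ->.
  have {}Bs : B (y + s *: (z - y)) by apply: Bs; case/andP: s01 => *; rewrite !ltW.
  have [_ ->] := dI g l _ (z - y) Cg Bs.
  apply: le_lt_trans zye; apply: unit_integral_bound.
    exact: continuous_ray (Ck_derive _ (Cg 2%N)) Bs.
  move=> t t01; apply: norm_monomial_le => //.
  have br := ball_ray Bs t01.
  rewrite (C1_derive_row _ oU (Cg 1%N)); last exact: aU.
  rewrite (le_trans (ler_norm_sum _ _ _))// /S mulrDr mulr1 mulr_sumr ler_wpDr//.
  apply: ler_sum => i _; rewrite normrM ler_pM//; first exact: mx_norm_ge_coord.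
  by have [_ ->] := CP i.
elim: k m f Cf => [|k IH] m f Cf; first by split=> // y; exact: cI.
split=> [y|v]; first exact: cI.
split=> [y By|]; first by have [] := dI f m y v Cf By.
apply: (Ck_eq open_ball_set _ (IH m.+1 ('D_v f) _)) => [y By|l].
  by have [_ ->] := dI f m y v Cf By.
exact: Ck_derive (Cf l.+1).
Qed.

(** The fundamental theorem of calculus for [f] along the ray from [a] to [y], with the derivative
    along [y - a] expanded in the standard basis under the integral. *)
Lemma hadamard_ball f y : (forall l, Ck l U f) -> B y ->
  f y = f a + \sum_i (y 0 i - a 0 i) * ray_moment a 0 ('D_'e_i f) y.
Proof.
move=> Cf By.
pose F (t : R) := f (a + t *: (y - a)).
have dF (t : R) : 0 <= t <= 1 ->
    is_derive t 1 F ('D_(y - a) f (a + t *: (y - a))).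
  move=> t01; apply/is_derive_lineP/derivableP.
  exact: Ck_derivable (Cf 1%N) (aU (ball_ray By t01)).
have cF (t : R) : 0 <= t <= 1 -> {for t, continuous F}.
  move=> /dF[d _]; apply: differentiable_continuous; exact/derivable1_diffP.
have c1 := continuous_ray (Ck_derive (y - a) (Cf 2%N)) By (m := 0%N).
have i0 : 0 <= (0 : R) <= 1 by rewrite lexx ler01.
have i1 : 0 <= (1 : R) <= 1 by rewrite lexx ler01.
have dLR : derivable_oo_LRcontinuous F 0 1.
  split=> [t||].
  - by rewrite in_itv/= => /andP[t0 t1]; have [] := dF t; rewrite ?ltW.
  - by apply: cvg_at_right_filter; exact: cF.
  - by apply: cvg_at_left_filter; exact: cF.
have := continuous_FTC2 ltr01 c1 dLR.
have -> : F 1 = f y by rewrite /F scale1r addrC subrK.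
have -> : F 0 = f a by rewrite /F scale0r addr0.
move=> /(_ _)/(congr1 fine) FTC; apply/eqP; rewrite addrC -subr_eq; apply/eqP.
rewrite -[LHS]FTC => [|t]; last first.
  rewrite in_itv/= derive1E => /andP[t0 t1].
  by have [] := dF t; rewrite ?expr0 ?mul1r ?ltW.
transitivity (unit_integral (fun t : R =>
    \sum_i (y - a) 0 i * (t ^+ 0 * 'D_'e_i f (a + t *: (y - a))))).
  apply: eq_Rintegral => t; rewrite inE/= in_itv/= => t01.
  rewrite (C1_derive_row _ oU (Cf 1%N)) ?mulr_sumr; last exact/aU/ball_ray.
  by apply: eq_bigr => i _; rewrite mulrCA.
rewrite unit_integral_sum => [|i]; first by apply: eq_bigr => i _; rewrite !mxE.
exact: continuous_ray (Ck_derive _ (Cf 2%N)) By.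
Qed.
End Ball.

Lemma hadamard U (f : 'rV[R]_n -> R) a :
  open U -> U a -> (forall k, Ck k U f) ->
  exists (B : set 'rV[R]_n) (g : 'I_n -> 'rV[R]_n -> R),
    [/\ open B, B a, B `<=` U, forall i k, Ck k B (g i) &
        forall y, B y -> f y = f a + \sum_i (y 0 i - a 0 i) * g i y].
Proof.
move=> oU Ua Cf; have [r r0 rU] := nbhs_norm_ball (open_nbhs_nbhs (conj oU Ua)).
(* Halving the radius puts the closed ball inside [U], as the compactness bounds require. *)
have aU y : `|y - a| <= r / 2 -> U y.
  by move=> yr; apply: rU; rewrite (le_lt_trans yr)// ltr_pdivrMr// ltr_pMr// ltr1n.
exists [set y | `|y - a| < r / 2], (fun i => ray_moment a 0 ('D_'e_i f)).
split; first exact: open_ball_set.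
- by rewrite /= subrr normr0 divr_gt0.
- by move=> y /= /ltW; exact: aU.
- by move=> i k; apply: (Ck_ray_moment oU aU) => l; exact: Ck_derive (Cf l.+1).
- by move=> y yr; exact: (hadamard_ball oU aU).
Qed.

End Hadamard.

(** * Weil algebras *)

Section WeilAlgebra.
Context {R : realType} {A : weilAlgType R}.
Implicit Types (a b : A) (c : R).

Definition body a : R := projT1 (cid (wideal_compl a)).

Lemma bodyP a : wideal (a - (body a)%:A).
Proof. by have [] := projT2 (cid (wideal_compl a)). Qed.

Lemma body_eq a c : wideal (a - c%:A) -> body a = c.
Proof. by move=> ac; have [_ u] := projT2 (cid (wideal_compl a)); exact: u. Qed.

Lemma wideal0 : wideal (0 : A).
Proof. by have := widealM 0 _ (bodyP 0); rewrite mul0r. Qed.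

Lemma widealZ c a : wideal a -> wideal (c *: a).
Proof. by move=> wa; have := widealM c%:A _ wa; rewrite mulr_algl. Qed.

Lemma wideal_sum (I : finType) (F : I -> A) :
  (forall i, wideal (F i)) -> wideal (\sum_i F i).
Proof. by move=> wF; apply: (big_ind (@wideal R A) wideal0 (@widealD _ A)). Qed.

Lemma body_alg c : body c%:A = c.
Proof. by apply: body_eq; rewrite subrr; exact: wideal0. Qed.

Lemma body_wideal a : wideal a -> body a = 0.
Proof. by move=> wa; apply: body_eq; rewrite scale0r subr0. Qed.

Lemma body_linear : linear_for *%R body.
Proof.
move=> c a b; apply: body_eq.
rewrite (_ : _ - _ = c *: (a - (body a)%:A) + (b - (body b)%:A)).
  by apply: widealD; [apply: widealZ|]; exact: bodyP.
by rewrite scalerBr addrACA -opprD scalerDl scalerA.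
Qed.
HB.instance Definition _ := GRing.isLinear.Build R A R _ body body_linear.

Lemma body_monoid : monoid_morphism body.
Proof.
split=> [|a b]; first by rewrite -[X in body X]scale1r body_alg.
apply: body_eq.
rewrite (_ : _ - _ = b * (a - (body a)%:A) + (body a)%:A * (b - (body b)%:A)).
  by apply: widealD; apply: widealM; exact: bodyP.
by rewrite !mulrBr (mulrC b a) (mulrC b) addrA subrK -scalerAl mul1r scalerA.
Qed.
HB.instance Definition _ := GRing.isMonoidMorphism.Build A R body body_monoid.

Definition nil a : A := a - (body a)%:A.

Lemma nil_linear : linear nil.
Proof.
move=> c a b; rewrite /nil linearP /= scalerBr addrACA -opprD.
by rewrite scalerDl scalerA.
Qed.
HB.instance Definition _ := GRing.isLinear.Build R A A _ nil nil_linear.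

Lemma nil_alg c : nil c%:A = 0.
Proof. by rewrite /nil body_alg subrr. Qed.

Lemma nil_wideal a : wideal (nil a).
Proof. exact: bodyP. Qed.

Lemma body_nil a : a = (body a)%:A + nil a.
Proof. by rewrite addrC subrK. Qed.

Lemma body_unit a : body a != 0 -> exists b, a * b = 1.
Proof.
by move=> a0; apply: contrapT => /wideal_local/body_wideal aE; rewrite aE eqxx in a0.
Qed.

Definition nilp : nat := projT1 (cid (@wideal_nilpotent R A)).

Lemma prod_wideal (s : seq A) : (nilp <= size s)%N ->
  (forall a, a \in s -> wideal a) -> \prod_(a <- s) a = 0.
Proof.
rewrite /nilp; case: cid => k /= kP ks sw.
rewrite -(cat_take_drop k s) big_cat /=.
have st : size (take k s) = k by rewrite size_take_min; apply/minn_idPl.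
rewrite (big_nth 0) st big_mkord kP ?mul0r// => i.
by apply: sw; apply: (mem_take (n0 := k)); rewrite mem_nth// st.
Qed.

(* The predicate is proved for the products of [j] elements of the ideal, for
   [j] decreasing from [nilp] to 0. *)
Lemma wideal_descent (Q : A -> Prop) :
  Q 0 -> (forall a, (forall h, wideal h -> Q (a * h)) -> Q a) -> Q 1.
Proof.
move=> Q0 Qh.
suff Qs j (s : seq A) : (nilp - size s <= j)%N -> (forall a, a \in s -> wideal a) ->
    Q (\prod_(a <- s) a).
  by have := Qs nilp [::]; rewrite big_nil; apply => //; exact: leq_subr.
elim: j s => [|j IH] s sj sw.
  by rewrite prod_wideal//; move: sj; rewrite leqn0 subn_eq0.
have [ns|sn] := leqP nilp (size s); first by rewrite prod_wideal.
apply: Qh => h wh; rewrite mulrC.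
have := IH (h :: s); rewrite big_cons; apply.
  by rewrite /= subnS -subn1 leq_subLR add1n.
by move=> a; rewrite inE => /predU1P[->|/sw].
Qed.

End WeilAlgebra.

(** * A-smooth functions *)

Lemma continuous_mx (R : realType) (T : topologicalType) m n (g : T -> 'M[R]_(m, n)) x :
  (forall i j, {for x, continuous (fun y => g y i j)}) -> {for x, continuous g}.
Proof.
move=> cg N [P PN sub]; have : \forall y \near x, forall i j, P i j (g y i j).
  by apply: filter_forall => i; apply: filter_forall => j; exact: cg (PN i j).
by apply: filterS => y Py; apply: sub.
Qed.

Lemma continuous_lincomb (R : realType) (V : normedModType R) (I : finType)
    (f : I -> V -> R) (c : I -> R) x :
  (forall i, {for x, continuous (f i)}) ->
  {for x, continuous (fun y => \sum_i f i y * c i)}.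
Proof.
by move=> cf; apply: cvgr_sum => i; apply: cvgM; [exact: cf|exact: cvg_cst].
Qed.

Section ACalculus.
Context {R : realType} {n : nat} {A : weilAlgType R}.
Local Notation dimA := (@wdim R A).
Local Notation mx_of := (@mx_of R n A).
Local Notation of_mx := (@of_mx R n A).
Implicit Types (X v : 'rV[A]_n) (F G : 'rV[A]_n -> A) (U : set 'rV[R]_n).

Lemma of_mxK : cancel of_mx mx_of.
Proof. by move=> Z; apply/matrixP => i j; rewrite !mxE wcoord_sum. Qed.

Lemma mx_of_line X v (t : R) : mx_of (X + t%:A *: v) = mx_of X + t *: mx_of v.
Proof. by apply/matrixP => i j; rewrite !mxE linearD /= mulr_algl linearZ. Qed.

Lemma wcoord_inj (a b : A) : (forall j, wcoord j a = wcoord j b) -> a = b.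
Proof. by move=> ab; rewrite (wcoordE a) (wcoordE b); apply: eq_bigr => j _; rewrite ab. Qed.

Lemma wcoordM (a b : A) j : wcoord j (a * b) =
  \sum_k wcoord k a * \sum_l wcoord l b * wcoord j (wbasis k * wbasis l).
Proof.
rewrite {1}(wcoordE a) {1}(wcoordE b) mulr_suml linear_sum; apply: eq_bigr => k _.
rewrite -scalerAl linearZ /= mulr_sumr linear_sum; congr (_ * _).
by apply: eq_bigr => l _; rewrite -scalerAr linearZ.
Qed.

Definition is_Aderive F X v (d : A) : Prop :=
  forall j, is_derive (mx_of X) (mx_of v) (Acoord F j) (wcoord j d).

Lemma is_AderiveP F X v d : is_Aderive F X v d <->
  forall j, is_derive (0 : R) 1 (fun t : R => wcoord j (F (X + t%:A *: v))) (wcoord j d).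
Proof.
split=> dF j; have := dF j.
- move/is_derive_line0P; rewrite /Acoord; congr is_derive.
  by apply/funext => t; rewrite -mx_of_line mx_ofK.
- move=> h; apply/is_derive_line0P; move: h; congr is_derive.
  by apply/funext => t; rewrite /Acoord -mx_of_line mx_ofK.
Qed.

Lemma is_Aderive_diffA F X v d : is_Aderive F X v d -> diffA F X v = d.
Proof. by move=> dF; apply: wcoord_inj => j; rewrite coord_diffA; have [] := dF j. Qed.

Lemma is_Aderive_eq F X v d d' : is_Aderive F X v d -> d = d' -> is_Aderive F X v d'.
Proof. by move=> + <-. Qed.

Lemma is_Aderive_cst (a : A) X v : is_Aderive (cst a) X v 0.
Proof.
move=> j; rewrite linear0; exact: (is_derive_cst (wcoord j a : R) (mx_of X) (mx_of v)).
Qed.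

Lemma is_AderiveD F G X v dF dG : is_Aderive F X v dF -> is_Aderive G X v dG ->
  is_Aderive (F + G) X v (dF + dG).
Proof.
move=> hF hG j; rewrite linearD /=.
rewrite (_ : Acoord _ j = Acoord F j + Acoord G j); first exact: is_deriveD.
by apply/funext => Z; rewrite /Acoord -[(F + G) _]/(F _ + G _) linearD.
Qed.

Lemma is_Aderive_sum (I : finType) (F : I -> 'rV[A]_n -> A) X v (dF : I -> A) :
  (forall i, is_Aderive (F i) X v (dF i)) -> is_Aderive (\sum_i F i) X v (\sum_i dF i).
Proof.
move=> hF; apply: (big_ind2 (fun F d => is_Aderive F X v d)) => //.
- exact: is_Aderive_cst.
- by move=> *; exact: is_AderiveD.
Qed.

Lemma is_derive_fsum (V : normedModType R) (I : finType) (f : I -> V -> R) x w (d : I -> R) :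
  (forall i, is_derive x w (f i) (d i)) -> is_derive x w (\sum_i f i) (\sum_i d i).
Proof.
move=> hf; apply: (big_ind2 (fun f d => is_derive x w f d)) => //.
- exact: is_derive_cst.
- by move=> *; exact: is_deriveD.
Qed.

Lemma AcoordM F G j : Acoord (F * G) j = \sum_k Acoord F k *
  \sum_l Acoord G l * cst (wcoord j (wbasis k * wbasis l)).
Proof.
apply/funext => Z; rewrite fct_sumE /Acoord -[(F * G) _]/(F _ * G _) wcoordM.
by apply: eq_bigr => k _; rewrite mulrfctE fct_sumE.
Qed.

Lemma is_AderiveM F G X v dF dG : is_Aderive F X v dF -> is_Aderive G X v dG ->
  is_Aderive (F * G) X v (dF * G X + F X * dG).
Proof.
move=> hF hG j; rewrite AcoordM linearD /= !wcoordM.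
pose t k l := wcoord j (wbasis k * wbasis l : A).
have hGt k l : is_derive (mx_of X) (mx_of v) (Acoord G l * cst (t k l))
    (wcoord l dG * t k l).
  have := is_deriveM (hG l) (is_derive_cst (t k l) (mx_of X) (mx_of v)).
  by rewrite scaler0 add0r /GRing.scale /= [t k l * _]mulrC.
have hS k := is_derive_fsum (hGt k).
apply: is_derive_eq (is_derive_fsum (fun k => is_deriveM (hF k) (hS k))) _.
rewrite -big_split; apply: eq_bigr => k _ /=.
rewrite /GRing.scale /= addrC fct_sumE /Acoord mx_ofK; congr (_ + _).
rewrite mulrC; congr (_ * _); apply: eq_bigr => l _.
by rewrite mulrfctE mx_ofK.
Qed.

Lemma is_AderiveZ (c : R) F X v d : is_Aderive F X v d ->
  is_Aderive (fun X => c *: F X) X v (c *: d).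
Proof.
move=> hF; have := is_AderiveM (is_Aderive_cst c%:A X v) hF.
rewrite mul0r add0r mulr_algl (_ : cst _ * F = fun X => c *: F X)//.
by apply/funext => Y; rewrite mulrfctE mulr_algl.
Qed.

Definition Ainj (y : 'rV[R]_n) : 'rV[A]_n := \row_i (y 0 i)%:A.
Definition rbody X : 'rV[R]_n := \row_i body (X 0 i).

Lemma AinjK y : rbody (Ainj y) = y.
Proof. by apply/rowP => i; rewrite !mxE body_alg. Qed.

Lemma rbody_line X v (t : R) : rbody (X + t%:A *: v) = rbody X + t *: rbody v.
Proof. by apply/rowP => i; rewrite !mxE raddfD /= rmorphM /= body_alg. Qed.

Definition over_set U : set 'rV[A]_n := rbody @^-1` U.
(** The same set as [over_set U], read in the real coordinates in which openness and derivatives are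
    expressed. *)
Definition mx_over U : set 'M[R]_(n, dimA) := (rbody \o of_mx) @^-1` U.

Lemma mx_overE U : mx_of @` over_set U = mx_over U.
Proof.
apply/seteqP; split=> [_ [X UX <-]|Z UZ]; first by rewrite /mx_over /= mx_ofK.
by exists (of_mx Z) => //; rewrite of_mxK.
Qed.

Lemma mx_overP U X : mx_over U (mx_of X) = over_set U X.
Proof. by rewrite /mx_over /= mx_ofK. Qed.

Lemma rbody_of_mxE (Z : 'M[R]_(n, dimA)) i :
  rbody (of_mx Z) 0 i = \sum_j Z i j * body (wbasis j : A).
Proof.
by rewrite !mxE linear_sum; apply: eq_bigr => j _; rewrite linearZ.
Qed.

Lemma rbody_of_mx_line (Z w : 'M[R]_(n, dimA)) (t : R) :
  rbody (of_mx (Z + t *: w)) = rbody (of_mx Z) + t *: rbody (of_mx w).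
Proof.
apply/rowP => i.
transitivity (rbody (of_mx Z) 0 i + t * rbody (of_mx w) 0 i); last first.
  by move: (rbody _) (rbody _) => u u'; rewrite !mxE.
rewrite !rbody_of_mxE mulr_sumr -big_split.
by apply: eq_bigr => j _; rewrite !mxE mulrDl mulrA.
Qed.

Lemma continuous_rbody_of_mx : continuous (rbody \o of_mx).
Proof.
move=> Z; apply: continuous_mx => k i; rewrite (ord1 k).
have -> : (fun Z => (rbody \o of_mx) Z 0 i) =
    (fun Z => \sum_j Z i j * body (wbasis j : A)).
  by apply/funext => w; exact: rbody_of_mxE.
by apply: continuous_lincomb => j; exact: coord_continuous.
Qed.

Lemma open_mx_over U : open U -> open (mx_over U).
Proof. by move=> oU; apply: open_comp => // Z _; exact: continuous_rbody_of_mx. Qed.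

Lemma A_smooth_onCk U F k j : open U -> A_smooth_on (over_set U) F ->
  Ck k (mx_over U) (Acoord F j).
Proof.
by move=> oU [/(_ j)[W [_ UW CW]] _]; rewrite -mx_overE; exact: Ck_sub UW (CW k).
Qed.

Lemma A_smooth_on_is_Aderive U F X v : open U -> A_smooth_on (over_set U) F ->
  over_set U X -> is_Aderive F X v (diffA F X v).
Proof.
move=> oU sF UX j; rewrite coord_diffA; apply: derivableP.
by apply: Ck_derivable (A_smooth_onCk 1 j oU sF) _; rewrite mx_overP.
Qed.

Lemma A_smooth_onP U F (dF : 'rV[A]_n -> 'rV[A]_n -> A) : open U ->
  (forall k j, Ck k (mx_over U) (Acoord F j)) ->
  (forall X v, over_set U X -> is_Aderive F X v (dF X v)) ->
  (forall X a v, dF X (a *: v) = a * dF X v) ->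
  A_smooth_on (over_set U) F.
Proof.
move=> oU CF hF lF; split=> [j|X UX a v].
  by exists (mx_over U); split=> //; [exact: open_mx_over|rewrite mx_overE].
by rewrite !(is_Aderive_diffA (hF _ _ UX)) lF.
Qed.

Lemma A_smooth_on_subset (D E : set 'rV[A]_n) F : D `<=` E ->
  A_smooth_on E F -> A_smooth_on D F.
Proof.
move=> DE [sF lF]; split=> [j|X DX]; last by apply: lF; exact: DE.
have [W [oW EW CW]] := sF j; exists W; split=> // _ [X DX <-].
by apply: EW; exists X => //; exact: DE.
Qed.

(* If [a h F = 0] for all [h] in the ideal, then [a F] has derivative
   [\sum_i a h_i d_i F = 0] along a direction [(h_i)] in the ideal. *)
Lemma A_smooth_on_eq0 U F : open U -> A_smooth_on (over_set U) F ->
  (forall y, U y -> F (Ainj y) = 0) -> forall X, over_set U X -> F X = 0.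
Proof.
move=> oU sF F0.
suff : forall X, over_set U X -> 1 * F X = 0 by move=> h X /h; rewrite mul1r.
apply: (@wideal_descent _ _ (fun a => forall X, over_set U X -> a * F X = 0)).
  by move=> X _; rewrite mul0r.
move=> a Qa X UX.
have oW := open_mx_over oU.
have dF Y v : over_set U Y -> is_Aderive F Y v (diffA F Y v).
  by move=> UY; exact: A_smooth_on_is_Aderive oU sF UY.
have dM b Y v : over_set U Y -> is_Aderive (cst b * F) Y v (b * diffA F Y v).
  by move=> UY; have := is_AderiveM (is_Aderive_cst b Y v) (dF Y v UY); rewrite mul0r add0r.
(* The function [a h F] vanishes on all of the open set over [U], hence so does its derivative in
   every direction. *)
have ad0 Y v h : over_set U Y -> wideal h -> a * h * diffA F Y v = 0.
  move=> UY wh; rewrite -(is_Aderive_diffA (dM (a * h) Y v UY)).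
  apply: is_Aderive_diffA => j.
  apply: near_eq_is_derive (is_Aderive_cst 0 Y v j).
  have nW : nbhs (mx_of Y) (mx_over U) by apply: open_nbhs_nbhs; rewrite /open_nbhs mx_overP.
  by apply: filterS nW => Z WZ; rewrite /Acoord mulrfctE /= Qa.
pose h : 'rV[A]_n := \row_i nil (X 0 i).
have hE : h = \sum_i nil (X 0 i) *: 'e_i.
  by rewrite {1}(row_sum_delta h); apply: eq_bigr => i _; rewrite mxE.
(* The segment from the real point below [X] to [X] stays in one fibre, hence over [U]; [a F] has
   derivative 0 along it and is 0 at its real end. *)
pose Y (t : R) := Ainj (rbody X) + t%:A *: h.
have UY t : over_set U (Y t).
  rewrite /over_set /= rbody_line AinjK (_ : rbody h = 0) ?scaler0 ?addr0//.
  by apply/rowP => i; rewrite !mxE body_wideal//; exact: nil_wideal.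
have d0 t : a * diffA F (Y t) h = 0.
  rewrite (_ : diffA F (Y t) h = \sum_i nil (X 0 i) * diffA F (Y t) 'e_i).
    by rewrite mulr_sumr big1// => i _; rewrite mulrA ad0//; exact: nil_wideal.
  (* A-smoothness provides homogeneity over [A]; additivity in the direction comes from class
     C^1. *)
  rewrite hE; transitivity (\sum_i diffA F (Y t) (nil (X 0 i) *: 'e_i)).
    apply: wcoord_inj => j; rewrite coord_diffA linear_sum.
    rewrite (_ : mx_of (\sum_i _) = \sum_i mx_of (nil (X 0 i) *: 'e_i)).
      rewrite (C1_derive_sum _ oW (A_smooth_onCk 1 j oU sF)) ?mx_overP//.
      by apply: eq_bigr => i _; exact/esym/coord_diffA.
    apply/matrixP => p q; rewrite mxE !summxE linear_sum; apply: eq_bigr => i _.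
    by rewrite [RHS]mxE.
  by apply: eq_bigr => i _; rewrite sF.2.
have Y1 : Y 1 = X.
  apply/rowP => i; rewrite !mxE scale1r mul1r; exact/esym/body_nil.
have Y0 : Y 0 = Ainj (rbody X) by rewrite /Y scale0r scale0r addr0.
apply: wcoord_inj => j; rewrite linear0 -Y1.
transitivity (wcoord j (a * F (Y 0))); last by rewrite Y0 F0// mulr0 linear0.
apply: (@is_derive_0_is_cst _ (fun t => wcoord j (a * F (Y t)))) => t.
have := dM a (Y t) h (UY t) j; rewrite d0 linear0.
rewrite /Y mx_of_line => /is_derive_lineP.
congr is_derive; apply/funext => s.
by rewrite /Acoord -mx_of_line mx_ofK.
Qed.

Lemma A_smooth_on_unique U F G : open U ->
  A_smooth_on (over_set U) F -> A_smooth_on (over_set U) G ->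
  (forall y, U y -> F (Ainj y) = G (Ainj y)) ->
  forall X, over_set U X -> F X = G X.
Proof.
move=> oU sF sG FG X UX; apply/eqP; rewrite -subr_eq0; apply/eqP.
apply: (A_smooth_on_eq0 oU (A_smooth_on_sub sF sG)) => // y Uy.
by rewrite !fctE FG// subrr.
Qed.
End ACalculus.

(** * Taylor extension of real smooth functions to A^n *)

Section TaylorExtension.
Context {R : realType} {n : nat} {A : weilAlgType R}.
Local Notation mx_of := (@mx_of R n A).
Local Notation of_mx := (@of_mx R n A).
Local Notation nilp := (@nilp R A).
Implicit Types (X v : 'rV[A]_n) (f g : 'rV[R]_n -> R) (U : set 'rV[R]_n).

Definition Csmooth U f := forall k, Ck k U f.

Lemma Csmooth_derive U f (v : 'rV[R]_n) : Csmooth U f -> Csmooth U ('D_v f).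
Proof. by move=> Cf k; exact: Ck_derive (Cf k.+1). Qed.

(* the homogeneous part [\sum_(i_1, .., i_m) (d_(i_1) .. d_(i_m) f) h_(i_1) .. h_(i_m)]
   of degree [m] in the nilpotent part [h] of [X] *)
Fixpoint taylor m f X : A :=
  if m is m'.+1 then \sum_i nil (X 0 i) * taylor m' ('D_'e_i f) X
  else (f (rbody X))%:A.

(** The term of degree [nilp] is already 0. It is kept because differentiation in the nilpotent part
    lowers the degree by one: the shifted sum then matches [Aext] of the partial derivative
    exactly. *)
Definition Aext f X : A := \sum_(m < nilp.+1) m`!%:R^-1 *: taylor m f X.

Lemma taylor_eq U m f g X : open U -> (forall x, U x -> f x = g x) ->
  over_set U X -> taylor m f X = taylor m g X.
Proof.
move=> oU; elim: m f g => [|m IH] f g fg UX /=; first by rewrite fg.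
apply: eq_bigr => i _; congr (_ * _); apply: IH => // x Ux.
by apply: near_eq_derive; near=> y; apply: fg; near: y; exact: open_nbhs_nbhs.
Unshelve. all: by end_near. Qed.

Lemma taylorS_wideal m f X : wideal (taylor m.+1 f X).
Proof.
by apply: wideal_sum => i; rewrite mulrC; apply: widealM; exact: nil_wideal.
Qed.

(** Each unfolding of [taylor] releases one factor of the ideal. The list [s] collects these
    factors, so that the induction ends on a product of at least [nilp] of them. *)
Lemma taylor_prod m f X (s : seq A) : (nilp <= m + size s)%N ->
  (forall a, a \in s -> wideal a) -> \prod_(a <- s) a * taylor m f X = 0.
Proof.
elim: m f s => [|m IH] f s ms sw /=; first by rewrite prod_wideal// mul0r.
rewrite mulr_sumr big1// => i _; rewrite mulrA (mulrC _ (nil _)).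
have := IH ('D_'e_i f) (nil (X 0 i) :: s); rewrite big_cons; apply.
  by rewrite /= addnS -addSn.
by move=> a; rewrite inE => /predU1P[->|/sw//]; exact: nil_wideal.
Qed.

Lemma taylor_nilp f X : taylor nilp f X = 0.
Proof.
by have := @taylor_prod nilp f X [::]; rewrite big_nil mul1r; apply; rewrite ?leq_addr.
Qed.

Lemma taylorS_Ainj m f y : taylor m.+1 f (Ainj y) = 0.
Proof. by rewrite /= big1// => i _; rewrite mxE nil_alg mul0r. Qed.

Lemma Aext_Ainj f y : Aext f (Ainj y) = (f y)%:A.
Proof.
rewrite /Aext big_ord_recl big1 => [|i _]; last by rewrite taylorS_Ainj scaler0.
by rewrite addr0 /= fact0 invr1 scale1r AinjK.
Qed.

Lemma Aext_wideal f X : wideal (Aext f X - (f (rbody X))%:A).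
Proof.
rewrite /Aext big_ord_recl /= fact0 invr1 scale1r [_ + \sum__ _]addrC addrK.
by apply: wideal_sum => i; apply: widealZ; exact: taylorS_wideal.
Qed.

Lemma Ck_Acoord_sum k (O : set 'M[R]_(n, wdim)) (I : finType)
    (F : I -> 'rV[A]_n -> A) : open O ->
  (forall i j, Ck k O (Acoord (F i) j)) -> forall j, Ck k O (Acoord (\sum_i F i) j).
Proof.
move=> oO CF j; have := Ck_sum oO (fun i => CF i j); apply: (Ck_eq oO) => Z _.
by rewrite fct_sumE /Acoord fct_sumE linear_sum.
Qed.

Lemma Ck_Acoord_mul k (O : set 'M[R]_(n, wdim)) (F G : 'rV[A]_n -> A) : open O ->
  (forall j, Ck k O (Acoord F j)) -> (forall j, Ck k O (Acoord G j)) ->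
  forall j, Ck k O (Acoord (F * G) j).
Proof.
move=> oO CF CG j; rewrite AcoordM; apply: Ck_sum => // i; apply: Ck_mul => //.
by apply: Ck_sum => // l; apply: Ck_mul => //; exact: Ck_cst.
Qed.

Lemma Ck_Acoord_alg U f k j : open U -> Csmooth U f ->
  Ck k (mx_over U) (Acoord (fun X : 'rV[A]_n => (f (rbody X))%:A) j).
Proof.
move=> oU Cf; have oW := open_mx_over (A := A) oU.
have C : Ck k (mx_over U) (f \o (rbody \o of_mx)).
  apply: (Ck_comp_affine (l := rbody \o of_mx) oW (@continuous_rbody_of_mx R n A) _ _ (Cf k)).
    by move=> Z w t; exact: rbody_of_mx_line.
  by [].
have := Ck_mul oW C (Ck_cst k (wcoord j (1 : A)) oW); apply: (Ck_eq oW) => Z _.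
by rewrite /Acoord linearZ.
Qed.

Lemma Ck_Acoord_coord (O : set 'M[R]_(n, wdim)) k i j : open O ->
  Ck k O (Acoord (fun X : 'rV[A]_n => X 0 i) j).
Proof.
move=> oO; apply: Ck_eq (Ck_coord k i j oO) => // Z _.
by rewrite /Acoord mxE wcoord_sum.
Qed.

Lemma Ck_Acoord_nil k i j :
  Ck k setT (Acoord (fun X : 'rV[A]_n => nil (X 0 i)) j).
Proof.
have oT : open [set: 'rV[R]_n] by exact: openT.
have oW : open [set: 'M[R]_(n, @wdim R A)] by exact: openT.
have C1 := Ck_Acoord_coord k i j oW.
have C2 := Ck_Acoord_alg k j oT (fun k => Ck_coord k 0 i oT).
have := Ck_add oW C1 (Ck_mul oW (Ck_cst k (-1) oW) C2); apply: (Ck_eq oW) => Z _.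
rewrite !fctE /Acoord /nil linearB /= mulN1r; congr (_ - wcoord j _%:A).
by rewrite mxE.
Qed.

Lemma Ck_taylor U m f k j : open U -> Csmooth U f ->
  Ck k (mx_over U) (Acoord (taylor m f : 'rV[A]_n -> A) j).
Proof.
move=> oU; have oW := open_mx_over (A := A) oU.
elim: m f j => [|m IH] f j Cf; first exact: Ck_Acoord_alg.
rewrite (_ : taylor m.+1 f =
    \sum_i (fun X : 'rV[A]_n => nil (X 0 i)) * taylor m ('D_'e_i f)).
  apply: Ck_Acoord_sum => // i l; apply: Ck_Acoord_mul => // p.
    by apply: Ck_sub (Ck_Acoord_nil k i p) => Z.
  by apply: IH; exact: Csmooth_derive.
by apply/funext => X; rewrite fct_sumE.
Qed.

Lemma is_Aderive_alg U f X v : open U -> Csmooth U f -> over_set U X ->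
  is_Aderive (fun X => (f (rbody X))%:A) X v (\sum_i body (v 0 i) *: ('D_'e_i f (rbody X))%:A).
Proof.
move=> oU Cf UX; apply/is_AderiveP => j.
have := derivableP (Ck_derivable (v := rbody v) (Cf 1%N) UX) => /is_derive_line0P h.
have := is_deriveM h (is_derive_cst (wcoord j (1 : A)) (0 : R) 1).
rewrite scaler0 add0r (C1_derive_row _ oU (Cf 1%N) UX) /GRing.scale /=.
rewrite (_ : wcoord j (\sum_i _) =
  wcoord j (1 : A) * \sum_i (rbody v) 0 i * 'D_'e_i f (rbody X)).
  congr is_derive; apply/funext => t.
  by rewrite mulrfctE /= -rbody_line linearZ.
rewrite mulr_sumr linear_sum; apply: eq_bigr => i _.
by rewrite !linearZ /= mxE /GRing.scale /= mulrA mulrC.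
Qed.

Lemma is_Aderive_nil i X v :
  is_Aderive (fun X : 'rV[A]_n => nil (X 0 i)) X v (nil (v 0 i)).
Proof.
apply/is_AderiveP => j.
rewrite (_ : (fun t : R => _) =
    (fun t : R => wcoord j (nil (X 0 i)) + t * wcoord j (nil (v 0 i)))).
  exact: is_derive_affine.
by apply/funext => t; rewrite !mxE mulr_algl addrC nil_linear wcoord_linear addrC.
Qed.

(** The body of [v] moves the base point and differentiates the coefficients; the nilpotent part of
    [v] differentiates the monomials, hence the factor [m] and the degree [m.-1]. For [m = 0] that
    second term carries the factor 0, so the value of [m.-1] is immaterial. *)
Lemma is_Aderive_taylor U m f X v : open U -> Csmooth U f -> over_set U X ->
  is_Aderive (taylor m f) X v
    (\sum_i (body (v 0 i) *: taylor m ('D_'e_i f) X +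
             m%:R *: (nil (v 0 i) * taylor m.-1 ('D_'e_i f) X))).
Proof.
move=> oU Cf UX; elim: m f Cf => [|m IH] f Cf.
  apply: (is_Aderive_eq (is_Aderive_alg v oU Cf UX)); apply: eq_bigr => i _.
  by rewrite scale0r addr0.
rewrite (_ : taylor m.+1 f =
    \sum_i (fun X : 'rV[A]_n => nil (X 0 i)) * taylor m ('D_'e_i f)); last first.
  by apply/funext => Y; rewrite fct_sumE.
apply: (is_Aderive_eq (is_Aderive_sum (fun i => is_AderiveM (is_Aderive_nil i X v)
  (IH _ (Csmooth_derive 'e_i Cf))))).
(* [taylor] takes its outermost partial derivative first, whereas the induction hypothesis adds the
   new one last; symmetry of second derivatives reconciles the two orders. *)
have swap m' i l : taylor m' ('D_'e_i ('D_'e_l f)) X = taylor m' ('D_'e_l ('D_'e_i f)) X.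
  apply: (@taylor_eq U m' _ _ X oU _ UX) => x Ux.
  by rewrite (C2_derive_derive 'e_i 'e_l oU (Cf 2%N) Ux).
rewrite big_split /= addrC; under eq_bigr do rewrite mulr_sumr.
rewrite exchange_big -big_split; apply: eq_bigr => i _ /=.
under eq_bigr do rewrite mulrDr.
rewrite big_split /= -addrA; congr (_ + _).
  rewrite scaler_sumr; apply: eq_bigr => l _; rewrite [RHS]scalerAr.
  exact: (congr1 (fun z => nil (X 0 l) * (body (v 0 i) *: z)) (swap m i l)).
rewrite mulrSr scalerDl scale1r; congr (_ + _).
case: m {IH} => [|m].
  by rewrite scale0r big1// => l _; rewrite scale0r mulr0.
rewrite /= mulr_sumr scaler_sumr; apply: eq_bigr => l _.
rewrite [X in _ = _ *: X]mulrCA [RHS]scalerAr.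
exact: (congr1 (fun z => nil (X 0 l) * (m.+1%:R *: (nil (v 0 i) * z))) (swap m i l)).
Qed.

(** Since [m / m! = 1 / (m-1)!], the terms in [nil (v 0 i)] sum, after a shift of index, to the same
    factor as the terms in [body (v 0 i)]. The two recombine to [v 0 i], which makes the derivative
    A-linear in [v]. *)
Lemma is_Aderive_Aext U f X v : open U -> Csmooth U f -> over_set U X ->
  is_Aderive (Aext f) X v (\sum_i v 0 i * Aext ('D_'e_i f) X).
Proof.
move=> oU Cf UX.
rewrite (_ : Aext f = \sum_(m < nilp.+1) (fun X => m`!%:R^-1 *: taylor m f X)); last first.
  by apply/funext => Y; rewrite fct_sumE.
apply: (is_Aderive_eq (is_Aderive_sum (fun m : 'I_nilp.+1 =>
  is_AderiveZ (m`!%:R^-1) (is_Aderive_taylor m v oU Cf UX)))).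
under eq_bigr do rewrite scaler_sumr.
rewrite exchange_big; apply: eq_bigr => i _ /=.
rewrite [X in _ = X * _]body_nil mulrDl.
under eq_bigr do rewrite scalerDr.
rewrite big_split /=; congr (_ + _).
  rewrite mulr_algl /Aext scaler_sumr; apply: eq_bigr => m _.
  by rewrite !scalerA mulrC.
rewrite big_ord_recl /= scale0r scaler0 add0r.
rewrite /Aext big_ord_recr /= taylor_nilp scaler0 addr0 mulr_sumr.
apply: eq_bigr => m _ /=; rewrite scalerA -scalerAr; congr (_ *: _).
by rewrite /bump add1n factS natrM invfM mulrAC mulVf ?mul1r// pnatr_eq0.
Qed.

Lemma A_smooth_Aext U f : open U -> Csmooth U f -> A_smooth_on (over_set U) (Aext f).
Proof.
move=> oU Cf; have oW := open_mx_over (A := A) oU.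
apply: (@A_smooth_onP _ _ _ U (Aext f) (fun X v => \sum_i v 0 i * Aext ('D_'e_i f) X)) => //.
- move=> k j; rewrite (_ : Aext f = \sum_(m < nilp.+1) cst (m`!%:R^-1)%:A * taylor m f).
    apply: Ck_Acoord_sum => // i l; apply: Ck_Acoord_mul => // p.
      exact: (Ck_cst k (wcoord p ((i`!%:R^-1)%:A : A)) oW).
    exact: Ck_taylor.
  by apply/funext => X; rewrite fct_sumE; apply: eq_bigr => m _; rewrite mulrfctE mulr_algl.
- by move=> X v UX; exact: (is_Aderive_Aext v oU Cf UX).
- by move=> X a v; rewrite mulr_sumr; apply: eq_bigr => i _; rewrite mxE mulrA.
Qed.

Lemma A_smooth_coord U i : open U -> A_smooth_on (over_set U) (fun X : 'rV[A]_n => X 0 i).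
Proof.
move=> oU; apply: (@A_smooth_onP _ _ _ U _ (fun X v => v 0 i)) => //.
- by move=> k j; apply: Ck_Acoord_coord; exact: open_mx_over.
- move=> X v _; apply/is_AderiveP => j.
  rewrite (_ : (fun t : R => _) = (fun t : R => wcoord j (X 0 i) + t * wcoord j (v 0 i))).
    exact: is_derive_affine.
  by apply/funext => t; rewrite !mxE mulr_algl linearD linearZ.
- by move=> X a v; rewrite mxE.
Qed.
End TaylorExtension.

(** * Points of the Weil bundle *)

Lemma open_setI_preimage (S T : topologicalType) (D : set S) (h : S -> T) (O : set T) :
  open D -> (forall x, D x -> {for x, continuous h}) -> open O ->
  open (D `&` h @^-1` O).
Proof.
move=> oD ch oO; rewrite openE => x [Dx Ox].
apply: filterI; first exact: open_nbhs_nbhs.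
by apply: (ch x Dx); exact: open_nbhs_nbhs.
Qed.

(** * Cut-offs and extension of local functions on the manifold *)

Section SmoothFunctions.
Context {R : realType} {n : nat} {M : manifold R n}.
Implicit Types (c d : chart R n M) (f g : Cinf M) (x : M).

Lemma CinfD f g x : (f + g) x = f x + g x. Proof. by []. Qed.
Lemma CinfB f g x : (f - g) x = f x - g x. Proof. by []. Qed.
Lemma CinfM f g x : (f * g) x = f x * g x. Proof. by []. Qed.

Lemma Cinf_ext f g : (forall x, f x = g x) -> f = g.
Proof. by move=> fg; apply/val_inj/funext. Qed.

Lemma Csmooth_chart c f : atlas c -> Csmooth (cimg c) (f \o cinv c).
Proof.
move=> Mc k; have := valP f; move=> /smooth_funP/(_ c Mc)[W [_ cW CW]].
exact: Ck_sub cW (CW k).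
Qed.

Lemma open_chart_preimage c (U : set 'rV[R]_n) : atlas c -> open U ->
  open (cdom c `&` c @^-1` U).
Proof.
by move=> /atlas_chart[oc _ _ cc _] oU; exact: open_setI_preimage.
Qed.

Lemma open_cinv_preimage c (N : set M) : atlas c -> open N ->
  open (cimg c `&` cinv c @^-1` N).
Proof.
by move=> /atlas_chart[_ oc _ _ cc] oN; exact: open_setI_preimage.
Qed.

Lemma cinvK c x : atlas c -> cdom c x -> cinv c (c x) = x.
Proof. by move=> /atlas_chart[_ _ + _ _]; exact. Qed.

Lemma chart_cinvK c (y : 'rV[R]_n) : atlas c -> cimg c y -> cdom c (cinv c y) /\ c (cinv c y) = y.
Proof. by move=> Mc [x cx <-]; rewrite cinvK. Qed.

(** A bump times [g], extended by 0 off the chart. Smoothness at points seen only in other charts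
    rests on the support lying in [K], the image of a closed ball: it is compact, hence closed
    because [M] is Hausdorff. Off [K] the function vanishes on an open set; at points of [K] it is
    [b * g] composed with a transition map. *)
Lemma extend_smooth c (U : set 'rV[R]_n) (g : 'rV[R]_n -> R) x :
  atlas c -> cdom c x -> open U -> U (c x) -> Csmooth U g ->
  exists f : Cinf M, (\forall y \near x, f y = g (c y)) /\
    forall y, f y != 0 -> cdom c y /\ U (c y).
Proof.
move=> Mc cx oU Ux Cg; have [ocd oci cK cc ccv] := atlas_chart Mc.
pose W := U `&` cimg c; have oW : open W by exact: openI.
have Wx : W (c x) by split=> //; exists x.
have [r r0 rW] := nbhs_norm_ball (open_nbhs_nbhs (conj oW Wx)).
(* The bump is 1 within [r/4] and 0 from [r/2] on, so the closed ball of radius [r/2], which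
   contains its support, remains inside [W]. *)
have r2 : 0 < r / 4 by rewrite divr_gt0.
have [b [Cb b1 b0]] := row_bump (c x) r2.
pose F y := if `[< cdom c y >] then b (c y) * g (c y) else 0.
pose K0 := [set y | `|y - c x| <= r / 2]; pose K := cinv c @` K0.
have K0W y : K0 y -> W y by move=> yr; apply: rW; rewrite (le_lt_trans yr)//; lra.
have clK : closed K.
  apply: compact_closed; first exact: manifold_hausdorff.
  apply: continuous_compact; last exact: compact_box.
  by apply: continuous_in_subspaceT => y /set_mem /K0W[_ yc]; exact: ccv.
have FK y : F y != 0 -> cdom c y /\ K0 (c y).
  rewrite /F; case: asboolP => [cy|_]; last by rewrite eqxx.
  move=> by0; split=> //; rewrite /K0 /= leNgt; apply/negP => yr.
  by move/eqP: by0; apply; rewrite b0 ?mul0r//; lra.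
have sF : F \in @smooth_fun R n M.
  apply/smooth_funP => d Md; have [odd odi dK cd cdv] := atlas_chart Md.
  exists (cimg d); split=> // k; apply: Ck_local => p [q dq pE].
  have [Kq|nKq] := pselect (K q); last first.
    exists (cimg d `&` cinv d @^-1` (~` K)); have oN : open (~` K) by exact: closed_openC.
    split; [exact: open_cinv_preimage|by split; [exists q|rewrite -pE /= dK]|].
    apply: Ck_eq (Ck_cst k 0 (open_cinv_preimage Md oN)); first exact: open_cinv_preimage.
    move=> z [_ nKz]; apply/esym/eqP/negPn/negP => /FK[cz K0z]; apply: nKz.
    by exists (c (cinv d z)) => //; rewrite cK.
  have [z K0z zq] := Kq; have [Uz [q' cq' q'z]] := K0W z K0z.
  have qq' : q = q' by rewrite -zq -q'z cK.
  pose S := cdom c `&` c @^-1` W; have oS : open S by exact: open_chart_preimage.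
  pose N := cimg d `&` cinv d @^-1` S; have oN : open N by exact: open_cinv_preimage.
  have Np : N p.
    split; [by exists q|rewrite -pE /= dK//; split; rewrite ?qq'//=].
    by rewrite q'z; exact: K0W.
  exists N; split=> //.
  have Cbg : Ck k W (b * g).
    by apply: Ck_mul => //; [exact: Ck_sub (Cb k)|apply: Ck_sub (Cg k) => y []].
  apply: (Ck_eq (f := (b * g) \o (c \o cinv d)) oN) => [y [_ [cy _]]|].
    by rewrite /F /= asboolT.
  apply: (Ck_comp_row oN oW Cbg) => [i|y [dy [cy _]]|y [_ []//]].
    have [W' [_ DW' CW']] := atlas_compatible Md Mc i.
    apply: Ck_sub (CW' k) => y [dy [cy _]]; apply: DW'.
    have [ddy yE] := chart_cinvK Md dy.
    by exists (cinv d y).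
  by apply: continuous_comp; [exact: cdv|exact: cc].
exists (MkCinf sF); split=> [|y /FK[cy /K0W[]]//].
have oV : open (cdom c `&` c @^-1` [set y | `|y - c x| < r / 4]).
  by apply: open_chart_preimage => //; exact: open_ball_set.
have : nbhs x (cdom c `&` c @^-1` [set y | `|y - c x| < r / 4]).
  by apply: open_nbhs_nbhs; split=> //; split=> //=; rewrite subrr normr0.
by apply: filterS => y [cy yr]; rewrite /= /F asboolT// b1// mul1r.
Qed.

Lemma Cinf_bump x (N : set M) : open N -> N x ->
  exists h : Cinf M, h x = 1 /\ forall y, h y != 0 -> N y.
Proof.
move=> oN Nx; have [c Mc cx] := atlas_cover x.
have oU := open_cinv_preimage Mc oN.
have Ux : (cimg c `&` cinv c @^-1` N) (c x) by split; [exists x|rewrite /= cinvK].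
have [h [h1 h0]] := extend_smooth Mc cx oU Ux (fun k => Ck_cst k 1 oU).
exists h; split=> [|y /h0[cy [_]]]; first exact: nbhs_singleton h1.
by rewrite /= cinvK.
Qed.

Lemma Cinf_separated (x y : M) : (forall f, f x = f y) -> x = y.
Proof.
move=> fxy; apply: contrapT => xy.
have oN : open (~` [set y]).
  apply: closed_openC; apply: compact_closed; first exact: manifold_hausdorff.
  exact: compact_set1.
have [h [h1 hN]] := Cinf_bump oN xy.
by apply: (hN y) => //; rewrite -fxy h1 oner_neq0.
Qed.
End SmoothFunctions.

(** * Near points, their coordinates, and functions on the Weil bundle *)

Section NearPoints.
Context {R : realType} {n : nat} {M : manifold R n} {A : weilAlgType R}.
Implicit Types (c d : chart R n M) (f g : Cinf M) (x : M) (xi : weil_bundle M A).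

Lemma near_to_body xi x f : near_to xi x -> body (xi f) = f x.
Proof. by move=> xix; apply: body_eq; exact: xix. Qed.

Lemma near_to_uniq xi (x y : M) : near_to xi x -> near_to xi y -> x = y.
Proof.
by move=> xix xiy; apply: Cinf_separated => f; rewrite -(near_to_body f xix) (near_to_body f xiy).
Qed.

(** For a cut-off [h] with [h x = 1], supported where [f = g], the product [h * (f - g)] is 0, while
    [xi h] has body 1 and is therefore invertible in [A]. *)
Lemma near_to_local xi x f g : near_to xi x -> (\forall y \near x, f y = g y) ->
  xi f = xi g.
Proof.
move=> xix fg; have [N oN [Nx Nfg]] : exists2 N, open N & N x /\ forall y, N y -> f y = g y.
  have : nbhs x (fun y => f y = g y) := fg.
  by rewrite nbhsE => -[N [oN Nx] Nfg]; exists N.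
have [h [h1 hN]] := Cinf_bump oN Nx.
have h0 : h * (f - g) = 0.
  apply: Cinf_ext => y; rewrite CinfM CinfB.
  have [->|/hN/Nfg->] := eqVneq (h y) 0; first by rewrite mul0r.
  by rewrite subrr mulr0.
have [b hb] : exists b, xi h * b = 1.
  by apply: body_unit; rewrite (near_to_body h xix) h1 oner_neq0.
have := congr1 (fun a => b * xi a) h0; rewrite rmorphM rmorph0 mulr0 mulrA.
by rewrite (mulrC b) hb mul1r rmorphB => /eqP; rewrite subr_eq0 => /eqP.
Qed.

Lemma germ_valueE xi x f (g : M -> R) : near_to xi x ->
  (\forall y \near x, f y = g y) -> germ_value xi g = xi f.
Proof.
move=> xix fg; rewrite /germ_value; case: xgetP => [a _ [y [f' [xiy f'g ->]]]|].
  have yx := near_to_uniq xiy xix; rewrite {}yx in f'g *.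
  apply: (near_to_local xix); apply: filterS2 f'g fg => z -> //.
by move=> /(_ (xi f)) []; exists x, f.
Qed.

(** Near points act on global functions only, so the chart coordinates are replaced by global
    functions with the same germs at [x]. *)
Lemma coord_extension c x : atlas c -> cdom c x ->
  exists u : 'I_n -> Cinf M, forall i, \forall y \near x, u i y = c y 0 i.
Proof.
move=> Mc cx; have oT : open [set: 'rV[R]_n] by exact: openT.
suff /choice[u uE] : forall i, exists f : Cinf M, \forall y \near x, f y = c y 0 i.
  by exists u.
move=> i; have [f [fE _]] := extend_smooth Mc cx oT I (fun k => Ck_coord k 0 i oT).
by exists f.
Qed.

Lemma wchartE c x xi (u : 'I_n -> Cinf M) i : near_to xi x ->
  (\forall y \near x, u i y = c y 0 i) -> wchart c xi 0 i = xi (u i).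
Proof. by move=> xix ux; rewrite mxE (germ_valueE xix ux). Qed.

Lemma rbody_wchart c x xi : atlas c -> cdom c x -> near_to xi x ->
  rbody (wchart c xi) = c x.
Proof.
move=> Mc cx xix; have [u uE] := coord_extension Mc cx.
apply/rowP => i; rewrite mxE (wchartE xix (uE i)) (near_to_body _ xix).
exact: nbhs_singleton (uE i).
Qed.

(* By Hadamard's lemma, the coefficients of [xi f - xi' f] in the differences
   [xi (g_i) - xi' (g_i)] lie in the ideal. *)
Lemma weil_point_eq c x xi xi' : atlas c -> cdom c x -> near_to xi x -> near_to xi' x ->
  wchart c xi = wchart c xi' -> forall f, xi f = xi' f.
Proof.
move=> Mc cx xix xix' E.
suff : forall f, 1 * (xi f - xi' f) = 0.
  by move=> h f; have := h f; rewrite mul1r => /eqP; rewrite subr_eq0 => /eqP.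
apply: (@wideal_descent _ _ (fun a => forall f, a * (xi f - xi' f) = 0)).
  by move=> f; rewrite mul0r.
move=> a Qa f; have [u uE] := coord_extension Mc cx.
have [_ oci _ _ _] := atlas_chart Mc.
have icx : cimg c (c x) by exists x.
have [B [g [oB Bx BU Cg fE]]] := hadamard oci icx (Csmooth_chart f Mc).
have /choice[G GE] i : exists G : Cinf M, \forall y \near x, G y = g i (c y).
  by have [G [GE _]] := extend_smooth Mc cx oB Bx (Cg i); exists G.
(* Hadamard's expansion rebuilt from global functions, so that a near point can be applied to it
   term by term; it has the germ of [f] at [x]. *)
pose f' := Cinf_cst M (f x) + \sum_i (u i - Cinf_cst M (c x 0 i)) * G i.
have f'E z : f' z = f x + \sum_i (u i z - c x 0 i) * G i z.
  by rewrite /f' CinfD (big_morph (fun h : Cinf M => h z) (id1 := 0) (op1 := +%R)).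
have ff' : \forall y \near x, f y = f' y.
  have nB : nbhs x (cdom c `&` c @^-1` B).
    by apply: open_nbhs_nbhs; split; [exact: open_chart_preimage|].
  have nu : \forall y \near x, forall i, u i y = c y 0 i by apply: filter_forall => i; exact: uE.
  have nG : \forall y \near x, forall i, G i y = g i (c y) by apply: filter_forall => i; exact: GE.
  near=> y.
  have [cy By] : (cdom c `&` c @^-1` B) y by near: y.
  have uy : forall i, u i y = c y 0 i by near: y.
  have Gy : forall i, G i y = g i (c y) by near: y.
  rewrite f'E; have := fE (c y) By; rewrite -![(f \o _) _]/(f (cinv c _)) !cinvK// => ->.
  by congr (_ + _); apply: eq_bigr => i _; rewrite uy Gy.
have xiE (z : weil_bundle M A) : near_to z x -> z f =
    (f x)%:A + \sum_i (z (u i) - (c x 0 i)%:A) * z (G i).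
  move=> zx; rewrite (near_to_local zx ff') rmorphD near_pointZ rmorph_sum; congr (_ + _).
  by apply: eq_bigr => i _; rewrite rmorphM rmorphB near_pointZ.
rewrite (xiE _ xix) (xiE _ xix') opprD addrACA subrr add0r -sumrB mulr_sumr big1// => i _.
rewrite -(wchartE xix (uE i)) -(wchartE xix' (uE i)) -E -mulrBr mulrA Qa//.
rewrite (wchartE xix (uE i)) -(nbhs_singleton (uE i)); exact: xix.
Unshelve. all: by end_near. Qed.

(** [f] is sent to the value at [X] of its Taylor extension. Each identity of a homomorphism
    compares two A-smooth functions of [X] that agree at real points, so it follows from their
    uniqueness, without computing with Taylor sums. *)
Lemma weil_point_over c (X : 'rV[A]_n) : atlas c -> over_set (cimg c) X ->
  exists xi : weil_bundle M A, [/\ near_to xi (cinv c (rbody X)),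
    wchart c xi = X & forall f, xi f = Aext (f \o cinv c) X].
Proof.
move=> Mc UX; have [_ oci _ _ _] := atlas_chart Mc.
pose phi f := Aext (f \o cinv c) X : A.
have sA f := A_smooth_Aext (A := A) oci (Csmooth_chart f Mc).
have phiB : zmod_morphism phi.
  move=> f g; apply: (A_smooth_on_unique oci (sA (f - g)) (A_smooth_on_sub (sA f) (sA g)) _ UX).
  by move=> y _; rewrite !fctE !Aext_Ainj /= scalerBl.
have phiM : monoid_morphism phi.
  split=> [|f g].
    apply: (A_smooth_on_unique oci (sA 1) (A_smooth_on_cst _ 1) _ UX).
    by move=> y _; rewrite Aext_Ainj /= scale1r.
  apply: (A_smooth_on_unique oci (sA (f * g)) (A_smooth_on_mul (sA f) (sA g)) _ UX).
  by move=> y _; rewrite !mulrfctE !Aext_Ainj /= -scalerAl mul1r scalerA.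
pose phi1 := GRing.isZmodMorphism.Build _ _ phi phiB.
pose phi2 := GRing.isMonoidMorphism.Build _ _ phi phiM.
pose Phi : {rmorphism Cinf M -> A} := HB.pack phi phi1 phi2.
have PhiZ a : Phi (Cinf_cst M a) = a%:A.
  apply: (A_smooth_on_unique oci (sA (Cinf_cst M a)) (A_smooth_on_cst _ a%:A) _ UX).
  by move=> y _; rewrite Aext_Ainj.
have Phix : near_to Phi (cinv c (rbody X)) by move=> f; exact: Aext_wideal.
pose xi := MkNearPoint PhiZ (ex_intro _ _ Phix).
have [cx cxE] := chart_cinvK Mc UX.
exists xi; split=> //; have [u uE] := coord_extension Mc cx.
apply/rowP => i; rewrite (wchartE (xi := xi) Phix (uE i)).
have : nbhs (cinv c (rbody X)) (fun y => u i y = c y 0 i) := uE i.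
rewrite nbhsE => -[N [oN Nx] Nu].
(* [u i] equals the coordinate on [N] only, so the comparison is made over the part of the chart
   image that corresponds to [N]. *)
have oU := open_cinv_preimage Mc oN.
have UX' : over_set (cimg c `&` cinv c @^-1` N) X by [].
apply: (A_smooth_on_unique (F := Aext (u i \o cinv c)) oU _ (A_smooth_coord i oU) _ UX').
  by apply: A_smooth_on_subset (sA (u i)) => Y [].
move=> y [yc Ny]; rewrite Aext_Ainj /= mxE Nu//.
by have [_ ->] := chart_cinvK Mc yc.
Qed.

Lemma near_pointE c xi f : atlas c -> wdom c xi ->
  xi f = Aext (f \o cinv c) (wchart c xi).
Proof.
move=> Mc [x cx xix]; have rE := rbody_wchart Mc cx xix.
have [|xi' [xi'x xi'E <-]] := @weil_point_over c (wchart c xi) Mc.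
  by rewrite /over_set /= rE; exists x.
rewrite rE cinvK// in xi'x.
exact: weil_point_eq Mc cx xix xi'x (esym xi'E) f.
Qed.

Lemma wchart_image c : atlas c -> wchart c @` wdom c = over_set (cimg c) :> set 'rV[A]_n.
Proof.
move=> Mc; apply/seteqP; split=> [_ [xi [x cx xix] <-]|X UX].
  by rewrite /over_set /= (rbody_wchart Mc cx xix); exists x.
have [xi [xix xiE _]] := weil_point_over Mc UX; exists xi => //.
by exists (cinv c (rbody X)) => //; have [] := chart_cinvK Mc UX.
Qed.

Lemma prolong_funE f xi : prolong_fun A f xi = xi f.
Proof.
have sf : (fun xi : weil_bundle M A => xi f) \in @wsmooth_fun R n M A.
  apply/wsmooth_funP => c Mc; have [_ oci _ _ _] := atlas_chart Mc.
  exists (Aext (f \o cinv c)); last by move=> z cz; exact: near_pointE.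
  by rewrite wchart_image//; apply: A_smooth_Aext => //; exact: Csmooth_chart.
by rewrite /prolong_fun -[LHS]/(val _ xi) insubdK.
Qed.

Lemma real_point_exists x : exists xi : weil_bundle M A, forall f, xi f = (f x)%:A.
Proof.
have [c Mc cx] := atlas_cover x.
have [|xi [_ _ xiE]] := @weil_point_over c (Ainj (c x)) Mc.
  by rewrite /over_set /= AinjK; exists x.
by exists xi => f; rewrite xiE Aext_Ainj /= cinvK.
Qed.

Definition real_point x : weil_bundle M A := projT1 (cid (real_point_exists x)).

Lemma real_pointE x f : real_point x f = (f x)%:A.
Proof. exact: (projT2 (cid (real_point_exists x))). Qed.

Lemma real_point_near x : near_to (real_point x) x.
Proof. by move=> f; rewrite real_pointE subrr; exact: wideal0. Qed.

Lemma wchart_real_point c x : atlas c -> cdom c x ->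
  wchart c (real_point x) = Ainj (c x).
Proof.
move=> Mc cx; have [u uE] := coord_extension Mc cx.
apply/rowP => i; rewrite (wchartE (real_point_near x) (uE i)) real_pointE mxE.
by rewrite (nbhs_singleton (uE i)).
Qed.

Lemma continuous_mx_of_Ainj : continuous (@mx_of R n A \o @Ainj R n A).
Proof.
move=> y; apply: continuous_mx => i j.
have -> : (fun z => (@mx_of R n A \o @Ainj R n A) z i j) =
    (fun z : 'rV[R]_n => \sum_(k < 1) z k i * wcoord j (1 : A)).
  by apply/funext => z; rewrite big_ord1 /= !mxE linearZ.
by apply: continuous_lincomb => k; exact: coord_continuous.
Qed.

Lemma mx_of_Ainj_line (y v : 'rV[R]_n) (t : R) :
  mx_of (Ainj (y + t *: v) : 'rV[A]_n) = mx_of (Ainj y) + t *: mx_of (Ainj v).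
Proof.
by apply/matrixP => i j; rewrite !mxE !linearZ /= /GRing.scale /= mulrDl mulrA.
Qed.

Lemma real_coord_smooth (phi : WCinf M A) j :
  (fun x => wcoord j (phi (real_point x))) \in @smooth_fun R n M.
Proof.
apply/smooth_funP => c Mc; have [_ oci _ _ _] := atlas_chart Mc.
have := valP phi; move=> /wsmooth_funP/(_ c Mc)[F + FE]; rewrite wchart_image// => sF.
exists (cimg c); split=> // k.
have : Ck k (cimg c) (Acoord F j \o (@mx_of R n A \o @Ainj R n A)).
  apply: (Ck_comp_affine (l := @mx_of R n A \o @Ainj R n A) oci continuous_mx_of_Ainj
     _ _ (A_smooth_onCk k j oci sF)).
    by move=> y v t; exact: mx_of_Ainj_line.
  by move=> y yc; rewrite mx_overP /over_set /= AinjK.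
apply: (Ck_eq oci) => y yc; have [cy yE] := chart_cinvK Mc yc.
rewrite /= /Acoord mx_ofK FE ?wchart_real_point ?yE//.
by exists (cinv c y) => //; exact: real_point_near.
Qed.

Definition real_coord (phi : WCinf M A) j : Cinf M := MkCinf (real_coord_smooth phi j).

Lemma A_smooth_on_sum (D : set 'rV[A]_n) (I : finType) (F : I -> 'rV[A]_n -> A) :
  (forall i, A_smooth_on D (F i)) -> A_smooth_on D (\sum_i F i).
Proof.
move=> sF; apply: (big_ind (A_smooth_on D)) => //; first exact: (A_smooth_on_cst D 0).
move=> G H sG sH; have := A_smooth_on_sub sG (A_smooth_on_sub (A_smooth_on_cst D 0) sH).
by rewrite opprB addrC -[cst 0]/(0 : 'rV[A]_n -> A) subr0 addrC.
Qed.

Lemma WCinf_ext (phi psi : WCinf M A) : (forall xi, phi xi = psi xi) -> phi = psi.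
Proof. by move=> E; apply/val_inj/funext. Qed.

Lemma WCinf_sum (I : finType) (F : I -> WCinf M A) xi : (\sum_i F i) xi = \sum_i F i xi.
Proof. exact: (big_morph (fun h : WCinf M A => h xi)). Qed.

Lemma WCinfM (phi psi : WCinf M A) xi : (phi * psi) xi = phi xi * psi xi.
Proof. by []. Qed.

(** In a chart both sides are A-smooth, and at real points the equation is the expansion of [phi] in
    the basis of [A]; uniqueness extends it to the fibres. *)
Lemma WCinf_decomposition (phi : WCinf M A) :
  phi = \sum_j WCinf_cst M (wbasis j) * prolong_fun A (real_coord phi j).
Proof.
apply: WCinf_ext => xi; rewrite WCinf_sum.
under eq_bigr do rewrite WCinfM prolong_funE.
have [x xix] := near_pointP xi; have [c Mc cx] := atlas_cover x.
have cxi : wdom c xi by exists x.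
have [_ oci _ _ _] := atlas_chart Mc.
have := valP phi; move=> /wsmooth_funP/(_ c Mc)[F + FE]; rewrite wchart_image// => sF.
under eq_bigr do rewrite (near_pointE _ Mc cxi).
rewrite -[LHS]/(val phi xi) FE//.
have sG : A_smooth_on (over_set (cimg c))
    (\sum_j (cst (wbasis j) * Aext (real_coord phi j \o cinv c))).
  apply: A_smooth_on_sum => j; apply: A_smooth_on_mul; first exact: A_smooth_on_cst.
  by apply: A_smooth_Aext => //; exact: Csmooth_chart.
have := A_smooth_on_unique oci sF sG; rewrite fct_sumE; apply.
  move=> y yc; have [cy yE] := chart_cinvK Mc yc.
  have cr : wdom c (real_point (cinv c y)) by exists (cinv c y) => //; exact: real_point_near.
  have <- : wchart c (real_point (cinv c y)) = Ainj y by rewrite wchart_real_point// yE.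
  rewrite -FE// [LHS]wcoordE; apply: eq_bigr => j _.
  by rewrite mulrfctE wchart_real_point// yE Aext_Ainj /= mulr_algr.
by rewrite -wchart_image//; exists xi.
Qed.
End NearPoints.

(** * Prolongation of vector fields and connections *)

Section DerivationTheory.
Variables (k : pzRingType) (B : comPzRingType) (j : {rmorphism k -> B}).
Implicit Types (X : Der j) (f g : B).

Lemma Der_add X f g : X (f + g) = X f + X g.
Proof. by have := (derP X).1 1 f g; rewrite rmorph1 !mul1r. Qed.

Lemma Der0 X : X 0 = 0.
Proof. by apply: (addIr (X 0)); rewrite -Der_add !add0r. Qed.

Lemma DerZ X a f : X (j a * f) = j a * X f.
Proof. by have := (derP X).1 a f 0; rewrite Der0 !addr0. Qed.

Lemma DerM X f g : X (f * g) = X f * g + f * X g.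
Proof. exact: (derP X).2. Qed.

Lemma sum_DerE (I : finType) (F : I -> Der j) f : (\sum_i F i) f = \sum_i F i f.
Proof. exact: (big_morph (fun X : Der j => X f)). Qed.

Variable D : Der j -> Der j -> Der j.
Hypothesis D_linear : linear_to_End D.

Lemma to_EndDl X X' Y : D (X + X') Y = D X Y + D X' Y.
Proof. by have := D_linear.1 1 X X' Y; rewrite !scale1r. Qed.

Lemma to_End0l Y : D 0 Y = 0.
Proof. by apply: (addIr (D 0 Y)); rewrite -to_EndDl !add0r. Qed.

Lemma to_EndZl b X Y : D (b *: X) Y = b *: D X Y.
Proof. by have := D_linear.1 b X 0 Y; rewrite to_End0l !addr0. Qed.

Lemma to_EndDr X Y Y' : D X (Y + Y') = D X Y + D X Y'.
Proof. by have := D_linear.2 X 1 Y Y'; rewrite rmorph1 !scale1r. Qed.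

Lemma to_End0r X : D X 0 = 0.
Proof. by apply: (addIr (D X 0)); rewrite -to_EndDr !add0r. Qed.

Lemma to_EndZr a X Y : D X (j a *: Y) = j a *: D X Y.
Proof. by have := D_linear.2 X a Y 0; rewrite to_End0r !addr0. Qed.
End DerivationTheory.

(** * A-linear extension of derivations and of connections *)

Section Prolongation.
Context {R : realType} {n : nat} {M : manifold R n} {A : weilAlgType R}.
Local Notation pf := (@prolong_fun R n M A).
Local Notation pv := (@prolong_vect R n M A).
Local Notation wcst := (@WCinf_cst R n M A).
Implicit Types (f g : Cinf M) (theta eta : vect M) (phi psi : WCinf M A) (X Y : wvect M A).

Lemma prolong_funD f g : pf (f + g) = pf f + pf g.
Proof.
by apply: WCinf_ext => xi; rewrite -[RHS]/(pf f xi + pf g xi) !prolong_funE rmorphD.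
Qed.

Lemma prolong_funM f g : pf (f * g) = pf f * pf g.
Proof. by apply: WCinf_ext => xi; rewrite WCinfM !prolong_funE rmorphM. Qed.

Lemma prolong_fun_cst (r : R) : pf (Cinf_cst M r) = wcst r%:A.
Proof. by apply: WCinf_ext => xi; rewrite prolong_funE near_pointZ. Qed.

Lemma real_coordD phi psi j : real_coord (phi + psi) j = real_coord phi j + real_coord psi j.
Proof. by apply: Cinf_ext => x; rewrite CinfD /= linearD. Qed.

Lemma real_coordMl f phi j : real_coord (pf f * phi) j = f * real_coord phi j.
Proof.
apply: Cinf_ext => x; rewrite CinfM.
by rewrite -[LHS]/(wcoord j (pf f (real_point x) * phi (real_point x)))
  prolong_funE real_pointE mulr_algl linearZ.
Qed.

Lemma real_coord_gen (a : A) f j :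
  real_coord (wcst a * pf f) j = Cinf_cst M (wcoord j a) * f.
Proof. by rewrite mulrC real_coordMl mulrC; congr (_ * _); exact: Cinf_ext. Qed.

Lemma wcst_sum (I : finType) (F : I -> A) : wcst (\sum_i F i) = \sum_i wcst (F i).
Proof. exact: raddf_sum. Qed.

Lemma wcstM (a b : A) : wcst (a * b) = wcst a * wcst b.
Proof. exact: rmorphM. Qed.

Lemma WCinf_ind (P : WCinf M A -> Prop) : P 0 ->
  (forall phi psi, P phi -> P psi -> P (phi + psi)) ->
  (forall (a : A) f, P (wcst a * pf f)) -> forall phi, P phi.
Proof.
move=> P0 PD Pg phi; rewrite (WCinf_decomposition phi).
by apply: (big_ind P) => // j _; exact: Pg.
Qed.

Lemma wvect_ext X Y : (forall f, X (pf f) = Y (pf f)) -> X = Y.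
Proof.
move=> XY; apply: der_ext; apply: WCinf_ind => [|phi psi E1 E2|a f].
- by rewrite !Der0.
- by rewrite !Der_add E1 E2.
- by rewrite !DerZ XY.
Qed.

(** The map [id (x) theta] on [A (x) C^oo(M)], written in the basis of [A] so that no
    well-definedness question arises. *)
Definition der_ext_fun theta phi : WCinf M A :=
  \sum_j wcst (wbasis j) * pf (theta (real_coord phi j)).

Lemma der_ext_funD theta phi psi :
  der_ext_fun theta (phi + psi) = der_ext_fun theta phi + der_ext_fun theta psi.
Proof.
rewrite -big_split; apply: eq_bigr => j _ /=.
by rewrite real_coordD Der_add prolong_funD mulrDr.
Qed.

Lemma der_ext_fun_gen theta (a : A) f :
  der_ext_fun theta (wcst a * pf f) = wcst a * pf (theta f).
Proof.
rewrite [in RHS](wcoordE a) wcst_sum mulr_suml; apply: eq_bigr => j _.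
rewrite real_coord_gen DerZ prolong_funM prolong_fun_cst mulrA -rmorphM.
by rewrite mulr_algr.
Qed.

Lemma der_ext_fun0 theta : der_ext_fun theta 0 = 0.
Proof. by apply: (addIr (der_ext_fun theta 0)); rewrite -der_ext_funD !add0r. Qed.

Lemma der_ext_funP theta : is_derivation wcst (der_ext_fun theta).
Proof.
split=> [a phi psi|phi psi].
  rewrite der_ext_funD; congr (_ + _); move: phi.
  apply: WCinf_ind => [|phi1 phi2 E1 E2|b f].
  - by rewrite mulr0 der_ext_fun0 mulr0.
  - by rewrite mulrDr !der_ext_funD E1 E2 mulrDr.
  - by rewrite mulrA -rmorphM !der_ext_fun_gen rmorphM mulrA.
move: phi psi; apply: WCinf_ind => [psi|phi1 phi2 E1 E2 psi|a f].
- by rewrite mul0r der_ext_fun0 !mul0r addr0.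
- by rewrite mulrDl !der_ext_funD E1 E2 !mulrDl addrACA.
apply: WCinf_ind => [|psi1 psi2 E1 E2|b g].
- by rewrite mulr0 der_ext_fun0 !mulr0 addr0.
- by rewrite mulrDr !der_ext_funD E1 E2 !mulrDr addrACA.
rewrite mulrACA -rmorphM -prolong_funM !der_ext_fun_gen DerM prolong_funD !prolong_funM.
by rewrite rmorphM mulrDr; congr (_ + _); rewrite mulrACA.
Qed.

(** [der_ext_fun theta] is a witness for the defining property, so the default value of [xget] is
    never taken. *)
Lemma prolong_vectE theta f : pv theta (pf f) = pf (theta f).
Proof.
rewrite /prolong_vect; case: xgetP => [X _|/(_ (MkDer (der_ext_funP theta)))]; first exact.
case=> g /=; have := der_ext_fun_gen theta 1 g.
by rewrite rmorph1 !mul1r.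
Qed.

Lemma prolong_vectD theta eta : pv (theta + eta) = pv theta + pv eta.
Proof.
apply: wvect_ext => f; rewrite prolong_vectE.
by rewrite -[RHS]/(pv theta (pf f) + pv eta (pf f)) !prolong_vectE prolong_funD.
Qed.

Lemma prolong_vectZ f theta : pv (f *: theta) = pf f *: pv theta.
Proof.
apply: wvect_ext => g; rewrite prolong_vectE.
by rewrite -[RHS]/(pf f * pv theta (pf g)) prolong_vectE prolong_funM.
Qed.

(** At a real point [f^A] takes the real value of [f], so extracting a coordinate commutes with
    multiplication by [f], and the product rule of [X] passes to each coordinate. *)
Lemma vect_coord_der X j : is_derivation (Cinf_cst M) (fun f => real_coord (X (pf f)) j).
Proof.
split=> [a f g|f g].
  by rewrite prolong_funD Der_add real_coordD prolong_funM prolong_fun_cst DerZ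
    -[in RHS]real_coordMl prolong_fun_cst.
by rewrite prolong_funM DerM real_coordD mulrC !real_coordMl mulrC.
Qed.

Definition vect_coord X j : vect M := MkDer (vect_coord_der X j).

Lemma vect_coordD X Y j : vect_coord (X + Y) j = vect_coord X j + vect_coord Y j.
Proof. by apply: der_ext => f; rewrite /= real_coordD. Qed.

Lemma vect_coord_gen (a : A) theta j :
  vect_coord (wcst a *: pv theta) j = Cinf_cst M (wcoord j a) *: theta.
Proof.
apply: der_ext => f; rewrite -[LHS]/(real_coord (wcst a * pv theta (pf f)) j).
by rewrite prolong_vectE real_coord_gen.
Qed.

Lemma wvect_decomposition X : X = \sum_j wcst (wbasis j) *: pv (vect_coord X j).
Proof.
apply: wvect_ext => f; rewrite sum_DerE [LHS]WCinf_decomposition.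
by apply: eq_bigr => j _; rewrite -[RHS]/(_ * pv _ (pf f)) prolong_vectE.
Qed.

Lemma wvect_ind (P : wvect M A -> Prop) : P 0 ->
  (forall X Y, P X -> P Y -> P (X + Y)) ->
  (forall (a : A) theta, P (wcst a *: pv theta)) -> forall X, P X.
Proof.
move=> P0 PD Pg X; rewrite (wvect_decomposition X).
by apply: (big_ind P) => // j _; exact: Pg.
Qed.

Lemma to_End_unique (D D' : wvect M A -> wvect M A -> wvect M A) :
  linear_to_End D -> linear_to_End D' ->
  (forall theta eta, D (pv theta) (pv eta) = D' (pv theta) (pv eta)) -> D = D'.
Proof.
move=> lD lD' DD'; apply/funext => X; apply/funext => Y; move: X Y.
apply: wvect_ind => [Y|X1 X2 E1 E2 Y|a theta].
- by rewrite !to_End0l.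
- by rewrite !to_EndDl// E1 E2.
apply: wvect_ind => [|Y1 Y2 E1 E2|b eta].
- by rewrite !to_End0r.
- by rewrite !to_EndDr// E1 E2.
- by rewrite !to_EndZl// !to_EndZr// DD'.
Qed.

Variable nabla : vect M -> vect M -> vect M.
Hypothesis nabla_linear : linear_to_End nabla.

Definition prolong_nabla X Y : wvect M A :=
  \sum_i \sum_j wcst (wbasis i * wbasis j) *: pv (nabla (vect_coord X i) (vect_coord Y j)).

Lemma prolong_nablaDl X X' Y :
  prolong_nabla (X + X') Y = prolong_nabla X Y + prolong_nabla X' Y.
Proof.
rewrite -big_split; apply: eq_bigr => i _; rewrite -big_split; apply: eq_bigr => j _ /=.
by rewrite vect_coordD to_EndDl// prolong_vectD scalerDr.
Qed.

Lemma prolong_nablaDr X Y Y' :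
  prolong_nabla X (Y + Y') = prolong_nabla X Y + prolong_nabla X Y'.
Proof.
rewrite -big_split; apply: eq_bigr => i _; rewrite -big_split; apply: eq_bigr => j _ /=.
by rewrite vect_coordD to_EndDr// prolong_vectD scalerDr.
Qed.

Lemma prolong_nabla0l Y : prolong_nabla 0 Y = 0.
Proof. by apply: (addIr (prolong_nabla 0 Y)); rewrite -prolong_nablaDl !add0r. Qed.

Lemma prolong_nabla0r X : prolong_nabla X 0 = 0.
Proof. by apply: (addIr (prolong_nabla X 0)); rewrite -prolong_nablaDr !add0r. Qed.

(** Linearity of [nabla] over the real constants pulls the coordinates of [a] and [b] out, where
    they recombine to [a * b]; the basis has disappeared from the result. *)
Lemma prolong_nabla_gen (a b : A) theta eta :
  prolong_nabla (wcst a *: pv theta) (wcst b *: pv eta) =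
  wcst (a * b) *: pv (nabla theta eta).
Proof.
rewrite [in RHS](wcoordE a) [in RHS](wcoordE b) wcstM !wcst_sum -scalerA scaler_suml.
apply: eq_bigr => i _; rewrite scaler_suml scaler_sumr; apply: eq_bigr => j _.
rewrite !vect_coord_gen to_EndZl// to_EndZr// !prolong_vectZ !prolong_fun_cst.
rewrite !scalerA -!rmorphM; congr (wcst _ *: _).
by rewrite -mulrA mulrACA !mulr_algr.
Qed.

(** Everything is additive, so the scalars and both fields may be taken among the generators.
    Linearity over [C^oo(M^A, A)] in [X] then reduces to linearity of [nabla] over [C^oo(M)]. *)
Lemma prolong_nabla_linear : linear_to_End prolong_nabla.
Proof.
split=> [phi X X' Y|X a Y Y'].
  rewrite prolong_nablaDl; congr (_ + _); move: phi X Y.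
  apply: WCinf_ind => [X Y|phi psi E1 E2 X Y|a f].
  - by rewrite !scale0r prolong_nabla0l.
  - by rewrite !scalerDl prolong_nablaDl E1 E2.
  apply: wvect_ind => [Y|X1 X2 E1 E2 Y|b theta].
  - by rewrite scaler0 prolong_nabla0l scaler0.
  - by rewrite scalerDr !prolong_nablaDl E1 E2 scalerDr.
  apply: wvect_ind => [|Y1 Y2 E1 E2|c eta].
  - by rewrite !prolong_nabla0r scaler0.
  - by rewrite !prolong_nablaDr E1 E2 scalerDr.
  (* The scalar [f^A] is absorbed into the field, as [f^A theta^A] is the prolongation of [f theta],
     and is released again after [nabla]. *)
  rewrite scalerA mulrAC -wcstM -scalerA -prolong_vectZ !prolong_nabla_gen.
  by rewrite to_EndZl// prolong_vectZ !scalerA [in RHS]mulrAC -wcstM mulrA.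
rewrite prolong_nablaDr; congr (_ + _); move: X Y.
apply: wvect_ind => [Y|X1 X2 E1 E2 Y|b theta].
- by rewrite !prolong_nabla0l scaler0.
- by rewrite !prolong_nablaDl E1 E2 scalerDr.
apply: wvect_ind => [|Y1 Y2 E1 E2|c eta].
- by rewrite scaler0 prolong_nabla0r scaler0.
- by rewrite scalerDr !prolong_nablaDr E1 E2 scalerDr.
by rewrite !scalerA -!wcstM !prolong_nabla_gen scalerA -wcstM mulrCA.
Qed.

Lemma prolong_nabla_prolong theta eta :
  prolong_nabla (pv theta) (pv eta) = pv (nabla theta eta).
Proof. by have := prolong_nabla_gen 1 1 theta eta; rewrite mulr1 rmorph1 !scale1r. Qed.
End Prolongation.

Theorem theorem7 (R : realType) (n : nat) (M : manifold R n)
  (paracompactM : paracompact M) (A : weilAlgType R)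
  (nabla : vect M -> vect M -> vect M) (nabla_conn : linear_connection nabla) :
  exists! nablaA : wvect M A -> wvect M A -> wvect M A,
    linear_to_End nablaA /\
    forall theta eta : vect M,
      nablaA (prolong_vect A theta) (prolong_vect A eta) =
      prolong_vect A (nabla theta eta).
Proof.
have [nabla_linear _] := nabla_conn.
have lin := prolong_nabla_linear (A := A) nabla_linear.
exists (prolong_nabla nabla); split.
  by split=> // theta eta; exact: prolong_nabla_prolong.
move=> D [lD DE]; apply: to_End_unique => // theta eta.
by rewrite DE prolong_nabla_prolong.
Qed.
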